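(* Suppose Assumptions 1 and 2 (both stated in the context) hold, and $K\ge2$. Let $D=C_{deg}\frac aK$ and $\theta=\chi a$, where the constant $C_{deg}$ is sufficiently large and $\chi>0$ is sufficiently small depending only on $\rho_+$. Let $\widehat\sigma^{(M)}\sim Q_A^{(M)}$ be the output of the Truncated Main Algorithm described in the context, with truncation level $M\ge1$ and $\eta=\frac{\varepsilon}{2D}$, on $A$ drawn from the SBM with ground truth $\sigma_0$. Put $\overline r_M=(1-e^{-1/4})^M$ and $\xi_M=\max\{-\log(1-\overline r_M),\ \log(1+(e^{1/4}-1)\overline r_M)\}$. There exist constants $L,c_1,c_2,c_3>0$ such that if $\varepsilon\ge L\log(nK)$, then $$\sup_{\sigma_0\in\Sigma}\mathbb E_{\sigma_0} r(\sigma_0,\widehat\sigma^{(M)})\le e^{\xi_M}\left[\exp\left\{-c_1\frac{nI}{K}\right\}+\frac{1}{nK}e^{-c_2\varepsilon}+(nK)^{-c_3A_0}\right].$$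
   Context: Setting. $n,K$ are positive integers with $K\mid n$, $s=n/K$; $[m]=\{1,\dots,m\}$. Undirected graphs on $[n]$ are identified with symmetric zero-diagonal matrices $A\in\{0,1\}^{n\times n}$; $E(A)$ is the set of unordered edges $ij$. $\Sigma=\{\sigma:[n]\to[K]: |\sigma^{-1}(k)|=s\ \forall k\in[K]\}$. $Y^\sigma_{ij}=\mathbf 1\{\sigma(i)=\sigma(j)\}$ is the cluster matrix of $\sigma\in\Sigma$. $h(\sigma,\tau)=|\{i:\sigma_i\ne\tau_i\}|$. $\mathfrak S_K$ is the group of permutations of $[K]$. The loss is $r(\sigma,\tau)=\frac1n\min_{\pi\in\mathfrak S_K}h(\pi\circ\sigma,\tau)$. $\|\cdot\|_1$ is the entrywise $\ell_1$ norm, $\langle A,B\rangle=\mathrm{Tr}(AB^T)$. SBM with ground truth $\sigma_0\in\Sigma$: the upper-triangular entries of $A$ are independent, $\mathbb P(A_{ij}=1)=a/n$ if $\sigma_0(i)=\sigma_0(j)$ and $b/n$ otherwise. $\mathbb E_{\sigma_0}$ is expectation over this $A$ and the algorithm's randomness. $I$ is the order-$1/2$ Rényi divergence between $\mathrm{Ber}(a/n)$ and $\mathrm{Ber}(b/n)$: $I=-2\log\big(\sqrt{\tfrac an\tfrac bn}+\sqrt{(1-\tfrac an)(1-\tfrac bn)}\big)$. Score. For $D>0$, $Y\in[0,1]^{n\times n}$, let $\widetilde H_{A,D}(Y)=\min_{q,z}\{\sum_{ij\in E(A)}z_{ij}Y_{ij}+D\sum_{i=1}^nq_i\}$ over $0\le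 q_i\le1$ $(i\in[n])$, $0\le z_{ij}\le1$ and $z_{ij}\ge1-q_i-q_j$ $(ij\in E(A))$. Let $\widetilde\Psi_{A,D}(Y)=\widetilde H_{A,D}(Y)-\lambda\sum_{i<j}Y_{ij}$ and $\widetilde T_{A,D}(\sigma)=\widetilde\Psi_{A,D}(Y^\sigma)$. Here $\lambda$ is the penalty parameter of the penalized likelihood score $T_A(\sigma)=\sum_{i<j}(A_{ij}-\lambda)\mathbf 1\{\sigma(i)=\sigma(j)\}$, chosen as in Klopp and Zadik (2026); the penalty does not depend on $A$, and since $\sum_{i<j}Y_{ij}$ is constant over the set $\mathcal C$ below (which contains all $Y^\sigma$, $\sigma\in\Sigma$), the value of $\lambda$ affects neither $\pi_A$ nor any step of the algorithm. With $\eta=\frac{\varepsilon}{2D}$, the Gibbs law is $\pi_A(\sigma)=\exp\{\eta\widetilde T_{A,D}(\sigma)\}/\sum_{\tau\in\Sigma}\exp\{\eta\widetilde T_{A,D}(\tau)\}$, $\sigma\in\Sigma$. Certificate. $\mathcal C=\{Y\in\mathbb R^{n\times n}: Y\succeq0,\ Y_{ii}=1\ \forall i,\ Y_{ij}\ge0\ \forall i,j,\ Y\mathbf 1=s\mathbf 1\}$ and, for a cluster matrix $Z$, $V_\theta(Z)=\max_{Y\in\mathcal C}\{\widetilde\Psi_{A,D}(Y)+\frac\theta n\|Y-Z\|_1\}$. Canonical labelings. For $\sigma,\sigma^\star\in\Sigma$, $\mathrm{Can}_{\sigma^\star}(\sigma)$ is the lexicographically smallest vector among the labelings $\pi\circ\sigma$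 with $\pi\in\arg\min_{\pi\in\mathfrak S_K}h(\pi\circ\sigma,\sigma^\star)$, and $R_{\sigma^\star}=\{\sigma\in\Sigma:\mathrm{Can}_{\sigma^\star}(\sigma)=\sigma\}$. Truncated Main Algorithm (output law denoted $Q_A^{(M)}$). Input $A$, $K,D,\theta,\varepsilon$, integer truncation level $M\ge1$, with $\eta=\frac{\varepsilon}{2D}$ and $\kappa=2\eta\theta/K$, so that $\kappa\ge\log(4n(K-1))$. 1. Compute an optimal solution $\widehat X$ of the candidate SDP: $\max_X\langle A,X\rangle$ s.t. $X\succeq0$, $X\mathbf 1\le\mathbf 1$, $\mathrm{Tr}(X)=K$, $X\ge0$ entrywise. 2. If $s\widehat X=Y^{\sigma}$ for some $\sigma\in\Sigma$, let $\sigma^\star$ be such a $\sigma$; otherwise choose an arbitrary $\sigma^\star\in\Sigma$. 3. Check whether $V_\theta(Y^{\sigma^\star})=\widetilde\Psi_{A,D}(Y^{\sigma^\star})$. 4. If yes, perform at most $M$ independent trials: propose $\sigma\in[K]^n$ with independent coordinates, $\mathbb P(\sigma_i=\sigma^\star_i)=\frac1{1+(K-1)e^{-\kappa}}$, $\mathbb P(\sigma_i=\ell)=\frac{e^{-\kappa}}{1+(K-1)e^{-\kappa}}$ for $\ell\ne\sigma^\star_i$; reject if $\sigma\notin\Sigma$ or $\sigma\notin R_{\sigma^\star}$; otherwise accept with probability $b_A(\sigma)=\exp\{\eta[\widetilde T_{A,D}(\sigma)-\widetilde T_{A,D}(\sigma^\star)]+\kappa h(\sigma,\sigma^\star)\}$.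 At the first acceptance, draw $\Pi\sim\mathrm{Unif}(\mathfrak S_K)$ and return $\Pi\circ\sigma$. If none of the $M$ proposals is accepted, draw $\Pi\sim\mathrm{Unif}(\mathfrak S_K)$ and return $\Pi\circ\sigma^\star$. 5. If the check in step 3 fails, sample exactly from $\pi_A$ by brute-force enumeration of $\Sigma$. Assumptions. $K,a,b$ may depend on $n$; $o(\cdot)$ refers to $n\to\infty$; constants are absolute positive constants. Assumption 1: there is an absolute constant $C_{\mathrm{mg}}>0$ with $K\log(K)\le C_{\mathrm{mg}}\log(n)$. Assumption 2: there are absolute constants $0<\rho_-\le\rho_+<1$ and $A_0>0$ with $\frac aK\ge A_0\log(nK)$, $a,b=o(n)$, and $0<\rho_-\le b/a\le\rho_+<1$. *)

(* Defs.v *)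
From HB Require Import structures.
From mathcomp Require Import all_boot all_order all_algebra all_fingroup.
From mathcomp Require Import all_classical all_reals all_analysis.

Set Implicit Arguments.
Unset Strict Implicit.
Unset Printing Implicit Defensive.

Import Order.TTheory GRing.Theory Num.Theory.
Import numFieldNormedType.Exports.

Local Open Scope classical_set_scope.
Local Open Scope ring_scope.

Section Labelings.
Variables n K : nat.

Definition labeling := {ffun 'I_n -> 'I_K}.

Definition Sigma : {set labeling} :=
  finset (fun s : labeling =>
    [forall k, #|finset (fun i => s i == k)| == (n %/ K)%N]).

Definition relabel (p : {perm 'I_K}) (s : labeling) : labeling :=
  [ffun i => p (s i)].

Definition hamming (s t : labeling) : nat := #|finset (fun i => s i != t i)|.

(* n is a neutral default for the minimum, since hamming is at most n. *)
Definition loss {R : realType} (s t : labeling) : R :=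
  (\big[minn/n]_(p : {perm 'I_K}) hamming (relabel p s) t)%:R / n%:R.

Definition best_perm (s t : labeling) : {perm 'I_K} :=
  [arg min_(p < 1%g) hamming (relabel p s) t].

Definition best_perms (s t : labeling) : {set {perm 'I_K}} :=
  finset (fun p => hamming (relabel p s) t
                   == hamming (relabel (best_perm s t) s) t).

(* codom s is the vector (s_1, ..., s_n); seqlexi carries the lexicographic
   order.  The minimising permutation need not be unique, but the minimal
   labeling is. *)
Definition canon_labeling (t s : labeling) : labeling :=
  relabel [arg min_(p < best_perm s t in best_perms s t)
             (codom (relabel p s) : seqlexi 'I_K)]%O s.

Definition canonical_set (t : labeling) : {set labeling} :=
  finset (fun s => (s \in Sigma) && (canon_labeling t s == s)).

End Labelings.

Definition is_graph n (A : 'M[bool]_n) : bool :=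
  (A^T == A) && [forall i, ~~ A i i].

Definition graph n := {A : 'M[bool]_n | is_graph A}.

Section Model.
Variables (R : realType) (n K : nat).
Implicit Types (A : graph n) (X Y Z : 'M[R]_n) (s t : labeling n K).

Definition adj A (i j : 'I_n) : bool := val A i j.

Definition adjmx A : 'M[R]_n := \matrix_(i, j) (adj A i j)%:R.

Definition cluster_mx s : 'M[R]_n := \matrix_(i, j) (s i == s j)%:R.

Definition renyi_half (a b : R) : R :=
  - 2 * ln (Num.sqrt (a / n%:R * (b / n%:R))
            + Num.sqrt ((1 - a / n%:R) * (1 - b / n%:R))).

Definition edge_prob (a b : R) s (i j : 'I_n) : R :=
  (if s i == s j then a else b) / n%:R.

Definition sbm (a b : R) s A : R :=
  \prod_(i : 'I_n) \prod_(j : 'I_n | (i < j)%N)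
    (if adj A i j then edge_prob a b s i j else 1 - edge_prob a b s i j).

Definition psdmx X : Prop :=
  X^T = X /\ forall v : 'cV[R]_n, 0 <= (v^T *m X *m v) 0 0.

Definition l1norm X : R := \sum_i \sum_j `|X i j|.

(* Unordered edges are represented by pairs i < j: only the entries of z and
   Y strictly above the diagonal are used. *)
Definition score_feasible A (q : 'I_n -> R) (z : 'M[R]_n) : Prop :=
  (forall i, 0 <= q i <= 1) /\
  (forall i j : 'I_n, (i < j)%N -> adj A i j ->
     0 <= z i j <= 1 /\ 1 - q i - q j <= z i j).

Definition score_obj A (D : R) Y (q : 'I_n -> R) (z : 'M[R]_n) : R :=
  \sum_(i : 'I_n) \sum_(j : 'I_n | (i < j)%N && adj A i j) z i j * Y i j
  + D * \sum_i q i.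

(* inf is a minimum: the feasible set is a nonempty polytope (in the entries
   that occur) and the objective is linear. *)
Definition Hscore A (D : R) Y : R :=
  inf (fun v : R => exists q z,
         score_feasible A q z /\ v = score_obj A D Y q z).

Definition Psi (lam : R) A (D : R) Y : R :=
  Hscore A D Y - lam * \sum_(i : 'I_n) \sum_(j : 'I_n | (i < j)%N) Y i j.

Definition Tscore (lam : R) A (D : R) s : R := Psi lam A D (cluster_mx s).

Definition gibbs_eta (eps D : R) : R := eps / (2 * D).

Definition gibbs (lam eps D : R) A s : R :=
  if s \in Sigma n K then
    expR (gibbs_eta eps D * Tscore lam A D s)
    / \sum_(t in Sigma n K) expR (gibbs_eta eps D * Tscore lam A D t)
  else 0.

Definition cert_set Y : Prop :=
  [/\ psdmx Y, forall i, Y i i = 1, forall i j, 0 <= Y i j &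
      forall i, \sum_j Y i j = (n %/ K)%:R].

(* sup is a maximum: cert_set is compact and the objective is continuous. *)
Definition Vcert (lam : R) A (D theta : R) Z : R :=
  sup (fun v : R => exists2 Y,
         cert_set Y & v = Psi lam A D Y + theta / n%:R * l1norm (Y - Z)).

Definition sdp_feasible X : Prop :=
  [/\ psdmx X, forall i, \sum_j X i j <= 1, \tr X = K%:R &
      forall i j, 0 <= X i j].

Definition sdp_optimal A X : Prop :=
  sdp_feasible X /\
  forall X', sdp_feasible X' ->
    \tr (adjmx A *m X'^T) <= \tr (adjmx A *m X^T).

(* t is a labeling that the rounding step may return on the SDP solution X:
   it is arbitrary when no labeling in Sigma reproduces X. *)
Definition rounding X t : Prop :=
  t \in Sigma n K /\
  ((exists2 s, s \in Sigma n K & (n %/ K)%:R *: X = cluster_mx s) ->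
   (n %/ K)%:R *: X = cluster_mx t).

Section TruncatedAlgorithm.
Variables (lam eps D theta : R) (M : nat) (A : graph n) (sstar : labeling n K).

Definition kappa : R := 2 * gibbs_eta eps D * theta / K%:R.

Definition certified : bool :=
  Vcert lam A D theta (cluster_mx sstar) == Psi lam A D (cluster_mx sstar).

Definition proposal s : R :=
  \prod_i ((if s i == sstar i then 1 else expR (- kappa))
           / (1 + (K%:R - 1) * expR (- kappa))).

Definition accept_weight s : R :=
  expR (gibbs_eta eps D * (Tscore lam A D s - Tscore lam A D sstar)
        + kappa * (hamming s sstar)%:R).

(* When the certificate holds, accept_weight is at most 1 on
   canonical_set sstar, so the minimum there is accept_weight itself; it only
   makes the acceptance probability meaningful without a proof. *)
Definition accept_prob s : R :=
  if s \in canonical_set sstar then Num.min 1 (accept_weight s) else 0.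

Definition reject_prob : R := \sum_s proposal s * (1 - accept_prob s).

(* Law of the labeling held after at most m trials, before the final random
   relabeling: the first accepted proposal, or sstar if there is none. *)
Fixpoint trials (m : nat) s : R :=
  if m is m'.+1 then proposal s * accept_prob s + reject_prob * trials m' s
  else (s == sstar)%:R.

Definition shuffle (P : labeling n K -> R) t : R :=
  \sum_(p : {perm 'I_K}) \sum_s
    #|{perm 'I_K}|%:R^-1 * P s * (relabel p s == t)%:R.

Definition trunc_law t : R :=
  if certified then shuffle (trials M) t else gibbs lam eps D A t.

End TruncatedAlgorithm.

(* sstar A is the labeling selected in the rounding step on the graph A. *)
Definition expected_loss (a b lam eps D theta : R) (M : nat)
    (sstar : graph n -> labeling n K) (s0 : labeling n K) : R :=
  \sum_(A : graph n) sbm a b s0 A *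
    \sum_t trunc_law lam eps D theta M A (sstar A) t * loss s0 t.

End Model.

Section Regime.
Variable R : realType.
Implicit Types (K : nat -> nat) (a b : nat -> R).

Definition valid_size K (n : nat) : bool := (0 < n)%N && (K n %| n)%N.

Definition assumption_clusters (Cmg : R) K : Prop :=
  forall n, valid_size K n -> (K n)%:R * ln (K n)%:R <= Cmg * ln n%:R.

Definition assumption_degrees (A0 rho_lo rho_hi : R) K a b : Prop :=
  [/\ forall n, valid_size K n ->
        A0 * ln (n * K n)%:R <= a n / (K n)%:R,
      a =o_\oo (fun n => n%:R : R),
      b =o_\oo (fun n => n%:R : R) &
      forall n, valid_size K n -> rho_lo <= b n / a n <= rho_hi].

Definition rbar (M : nat) : R := (1 - expR (- (1 / 4))) ^+ M.

Definition xi (M : nat) : R :=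
  Num.max (- ln (1 - rbar M)) (ln (1 + (expR (1 / 4) - 1) * rbar M)).

End Regime.

(* Main.v *)
Require Import Defs.
From HB Require Import structures.
From mathcomp Require Import all_boot all_order all_algebra all_fingroup.
From mathcomp Require Import all_classical all_reals all_analysis.
From mathcomp Require Import zify ring lra.

Set Implicit Arguments.
Unset Strict Implicit.
Unset Printing Implicit Defensive.

Import Order.TTheory GRing.Theory Num.Theory.

Local Open Scope ring_scope.

(** Hall's theorem splits the confusion matrix of two balanced labelings into
    n/K permutation matrices, so two labelings at orbit distance m satisfy
    |Y^s - Y^t|_1 >= 2 (n/K) m.  With the certificate this makes every
    acceptance weight at most 1; acceptance then happens with probability at
    least e^(-1/4) per trial, and the output law is at most e^xi times the
    Gibbs law pi_A.

    For pi_A itself, the orbit of the truth alone bounds the partition function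
    from below, so pi_A(t) <= min(1, e^(eta (T t - T s0))) / K!, and capping the
    degrees costs at most a degree excess of s0, which is exponentially small on
    average.  Either the raw score of t comes within a margin proportional to
    a m / K of that of s0, which a Chernoff bound makes unlikely, or the
    temperature makes pi_A(t) small.  Summing over t by exponential tilting gives
    the last two terms of the bound; the term in n I / K is only needed to be
    nonnegative. *)

(** The comparison with [gibbs] is made graph by graph, on either outcome of the check, since the
    fallback branch is exact. No probability of certification enters, and all randomness is confined
    to the mean risk of the Gibbs law.

    The obstacle there is entropy: up to (e n K / m)^m labelings lie at Hamming distance m, against
    exponents of order a m / K. Labelings within distance x n of the truth are therefore not counted
    but charged x, a third of (nK)^(-c3 A0); beyond x n the entropy is about log(K/x) per misplaced
    vertex. Assumption 1 forces K = O(log n), so K is absorbed by a small power of nK. The factor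
    1/K! in the Gibbs bound turns a count of labelings into a count of orbits.

    The same x n fixes the tolerance for the degree excess, which has to stay below the margin at
    the smallest counted distance. The excess is a sum of exponentials so that one moment generating
    function estimate serves both it and the score differences. *)

(** * Hall's marriage theorem *)

Section Hall.
Local Open Scope nat_scope.
Variables I J : finType.
Implicit Types (F G : {ffun I -> {set J}}) (X : {set I}).

Definition nbhd F X : {set J} := \bigcup_(i in X) F i.

Definition hall_cond F := [forall X : {set I}, #|X| <= #|nbhd F X|].

Definition shrink F i x : {ffun I -> {set J}} :=
  [ffun k => if k == i then F i :\ x else F k].

Lemma shrink_sub F i x k : shrink F i x k \subset F k.
Proof. by rewrite ffunE; case: eqP => [->|_//]; exact: subD1set. Qed.

Lemma nbhd_shrink F i x X :
  i \in X -> nbhd (shrink F i x) X = (F i :\ x) :|: nbhd F (X :\ i).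
Proof.
move=> iX; rewrite /nbhd (big_setD1 i) //= ffunE eqxx; congr (_ :|: _).
by apply: eq_bigr => k; rewrite !inE ffunE => /andP[/negPf->].
Qed.

Lemma shrink_notin F i x X : i \notin X -> nbhd (shrink F i x) X = nbhd F X.
Proof.
move=> iX; apply: eq_bigr => k kX; rewrite ffunE.
by case: eqP => // ki; rewrite -ki kX in iX.
Qed.

Lemma shrink_violator F i x : hall_cond F -> ~~ hall_cond (shrink F i x) ->
  exists2 X : {set I}, i \notin X & #|(F i :\ x) :|: nbhd F X| <= #|X|.
Proof.
move=> /forallP hF /forallPn[X]; rewrite -ltnNge => ltX.
have iX : i \in X.
  by apply: contraLR ltX => /shrink_notin->; rewrite -leqNgt hF.
exists (X :\ i); first by rewrite !inE eqxx.
by move: ltX; rewrite nbhd_shrink // [#|X|](cardsD1 i) iX.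
Qed.

(* Rado's argument: by submodularity of the neighbourhood size, one of two
   choices for i can always be discarded. *)
Lemma hall_cond_shrink F i x y : hall_cond F -> x \in F i -> y \in F i ->
  x != y -> hall_cond (shrink F i x) || hall_cond (shrink F i y).
Proof.
move=> hF xF yF xy; apply/negPn/negP; rewrite negb_or => /andP[].
move=> /(shrink_violator hF)[X iX leX] /(shrink_violator hF)[Y iY leY].
set U := _ :|: _ in leX; set V := _ :|: _ in leY.
move/forallP: hF => hF.
have sU : nbhd F (i |: (X :|: Y)) \subset U :|: V.
  apply/bigcupsP => k; rewrite !inE => /orP[/eqP->|/orP[kX|kY]].
  - apply/fintype.subsetP => z zF; rewrite !inE zF !andbT.
    by have [->|_] := eqVneq z x; rewrite ?xy ?orbT.
  - apply/fintype.subsetP => z zF; rewrite !inE; suff -> : z \in nbhd F X by rewrite !orbT.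
    by apply/bigcupP; exists k.
  - apply/fintype.subsetP => z zF; rewrite !inE; suff -> : z \in nbhd F Y by rewrite !orbT.
    by apply/bigcupP; exists k.
have sI : nbhd F (X :&: Y) \subset U :&: V.
  apply/bigcupsP => k; rewrite inE => /andP[kX kY].
  apply/fintype.subsetP => z zF; rewrite !inE.
  have -> : z \in nbhd F X by apply/bigcupP; exists k.
  have -> : z \in nbhd F Y by apply/bigcupP; exists k.
  by rewrite !orbT.
(* The two bounds add up to |U| + |V| >= |X| + |Y| + 1, the extra 1 being [i]; this contradicts
   [leX] and [leY]. *)
have := leq_trans (hF _) (subset_leq_card sU).
have := leq_trans (hF _) (subset_leq_card sI).
rewrite cardsU1 !inE (negPf iX) (negPf iY) /=.
have := cardsUI U V; have := cardsUI X Y; lia.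
Qed.

(** A subfamily of least total size that keeps Hall's condition consists of singletons, since a set
    with two elements could be shrunk. Hall's condition on pairs then makes these singletons
    distinct. *)
Theorem hall_marriage F : hall_cond F ->
  exists f : {ffun I -> J}, injective f /\ forall i, f i \in F i.
Proof.
move=> hF.
pose P G := hall_cond G && [forall i, G i \subset F i].
have PF : P F by rewrite /P hF; apply/forallP.
case: (arg_minnP (fun G : {ffun I -> {set J}} => \sum_i #|G i|) PF).
move=> G /andP[hG /forallP sG] minG.
have card1 i : #|G i| = 1.
  apply/eqP; rewrite eqn_leq; apply/andP; split; last first.
    move/forallP/(_ [set i]): hG; rewrite cards1 => /leq_trans; apply.
    by rewrite /nbhd big_set1.
  rewrite leqNgt; apply/negP => /card_gt1P[x [y [xG yG xy]]].
  have shrinkF z : z \in G i -> ~~ hall_cond (shrink G i z).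
    move=> zG; apply/negP => hs; have /minG : P (shrink G i z).
      rewrite /P hs; apply/forallP => k; exact: fintype.subset_trans (shrink_sub _ _ _ _) (sG k).
    rewrite leqNgt; apply/negP; rewrite negbK.
    rewrite (bigD1 i) //= [X in _ < X](bigD1 i) //= ffunE eqxx.
    rewrite -addSn leq_add //; first by rewrite [#|G i|](cardsD1 z) zG.
    by apply: leq_sum => k /negPf ki; rewrite ffunE ki.
  have /orP[] := hall_cond_shrink hG xG yG xy.
    by apply/negP/shrinkF.
  by apply/negP/shrinkF.
have exG i : {x | G i = [set x]}.
  by apply: cid; have /eqP/cards1P := card1 i.
exists [ffun i => sval (exG i)]; split=> [i j|i]; rewrite !ffunE; last first.
  by apply: (fintype.subsetP (sG i)); case: (exG i) => x /= ->; rewrite inE.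
case: (exG i) (exG j) => x Gx [y Gy] /= xy.
apply/eqP/negPn/negP => ij; move/forallP/(_ [set i; j]): hG.
by rewrite cards2 ij /nbhd finset.bigcup_setU !big_set1 Gx Gy xy finset.setUid cards1.
Qed.
End Hall.

(** * Birkhoff's theorem for matrices with constant row and column sums *)

Section Assignment.
Local Open Scope nat_scope.
Variable K : nat.
Implicit Types (N W : 'I_K -> 'I_K -> nat).

Definition regular_mx S N :=
  (forall k, \sum_l N k l = S) /\ (forall l, \sum_k N k l = S).

(** Hall's condition by double counting: the rows in X carry mass S|X|, all of it in the columns of
    their neighbourhood, which carry S times their number. *)
Lemma regular_perm S N : 0 < S -> regular_mx S N ->
  exists p : {perm 'I_K}, forall k, 0 < N k (p k).
Proof.
move=> S0 [rowN colN].
pose F := [ffun k => finset (fun l => 0 < N k l)].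
have hF : hall_cond F.
  apply/forallP => X; rewrite -(leq_pmul2l S0).
  have -> : S * #|X| = \sum_(k in X) \sum_l N k l.
    by rewrite (eq_bigr (fun=> S)) ?sum_nat_const 1?mulnC// => k _; rewrite rowN.
  have -> : S * #|nbhd F X| = \sum_(l in nbhd F X) \sum_k N k l.
    by rewrite (eq_bigr (fun=> S)) ?sum_nat_const 1?mulnC// => k _; rewrite colN.
  rewrite exchange_big /= (bigID (fun l => l \in nbhd F X)) /=.
  rewrite addnC big1 ?add0n => [|l lX].
    by apply: leq_sum => l _; rewrite [leqRHS](bigID (fun k => k \in X)) leq_addr.
  apply: big1 => k kX; apply/eqP; rewrite -leqn0 leqNgt; apply: contra lX => Nkl.
  by apply/bigcupP; exists k => //; rewrite ffunE inE.
have [f [fI fF]] := hall_marriage hF.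
by exists (perm fI) => k; have := fF k; rewrite permE ffunE inE.
Qed.

(* Birkhoff's theorem: N is a sum of S permutation matrices. *)
Lemma regular_mx_bound S N W B : regular_mx S N ->
    (forall p : {perm 'I_K}, \sum_k W k (p k) <= B) ->
  \sum_k \sum_l N k l * W k l <= S * B.
Proof.
move=> + WB; elim: S N => [|S IH] N rN.
  rewrite big1 // => k _; rewrite big1 // => l _; move: (rN.1 k) => /eqP.
  by rewrite sum_nat_eq0 => /forallP/(_ l)/= /eqP->.
have [p Np] := regular_perm (ltn0Sn S) rN.
pose N' k l := N k l - (l == p k).
have NE k l : N k l = N' k l + (l == p k).
  by rewrite /N' subnK //; case: eqP => // ->.
have rN' : regular_mx S N'.
  have row1 k : \sum_l nat_of_bool (l == p k) = 1.
    by rewrite (bigD1 (p k)) //= eqxx big1 // => l /negPf->.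
  have col1 l : \sum_k nat_of_bool (l == p k) = 1.
    rewrite (bigD1 (p^-1%g l)) //= permKV eqxx big1 // => k kl.
    by case: eqP => // lk; rewrite lk permK eqxx in kl.
  split=> k; apply/eqP; rewrite -(eqn_add2r 1); [move: (rN.1 k)|move: (rN.2 k)].
    under eq_bigr do rewrite NE.
    by rewrite big_split /= row1 [S + 1]addn1 => <-.
  under eq_bigr do rewrite NE.
  by rewrite big_split /= col1 [S + 1]addn1 => <-.
rewrite mulSn addnC; apply: leq_trans (leq_add (IH _ rN') (WB p)).
rewrite -big_split /=; apply: leq_sum => k _.
rewrite [X in _ + X](_ : _ = \sum_l (l == p k) * W k l); last first.
  by rewrite (bigD1 (p k)) //= eqxx mul1n big1 ?addn0 // => l /negPf->.
by rewrite -big_split leq_sum // => l _; rewrite NE mulnDl.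
Qed.
End Assignment.

(** * Relabeling orbits, canonical representatives and common pairs *)

Section LabelingTheory.
Variables n K : nat.
Implicit Types (p q : {perm 'I_K}) (s t u : labeling n K).

Definition orbit_dist s t : nat := \big[minn/n]_p hamming (relabel p s) t.

Lemma relabel1 s : relabel 1 s = s.
Proof. by apply/ffunP => i; rewrite ffunE perm1. Qed.

Lemma relabelM p q s : relabel (p * q)%g s = relabel q (relabel p s).
Proof. by apply/ffunP => i; rewrite !ffunE permM. Qed.

Lemma relabelK p : cancel (@relabel n K p) (relabel p^-1%g).
Proof. by move=> s; rewrite -relabelM mulgV relabel1. Qed.

Lemma relabelVK p : cancel (@relabel n K p^-1%g) (relabel p).
Proof. by move=> s; rewrite -relabelM mulVg relabel1. Qed.

Lemma relabel_inj p : injective (@relabel n K p).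
Proof. exact: can_inj (relabelK p). Qed.

Lemma SigmaP s :
  reflect (forall k, #|finset (fun i => s i == k)| = (n %/ K)%N) (s \in Sigma n K).
Proof. by rewrite inE; apply: (iffP forallP) => h k; apply/eqP. Qed.

Lemma relabel_Sigma p s : (relabel p s \in Sigma n K) = (s \in Sigma n K).
Proof.
have H q u : u \in Sigma n K -> relabel q u \in Sigma n K.
  move=> /SigmaP uS; apply/SigmaP => k; rewrite -(uS (q^-1%g k)).
  by apply: eq_card => i; rewrite !inE ffunE (canF_eq (permK q)).
by apply/idP/idP; [move/(H p^-1%g); rewrite relabelK|exact: H].
Qed.

Lemma Sigma_onto s k : (0 < n %/ K)%N -> s \in Sigma n K -> exists i, s i = k.
Proof.
move=> S0 /SigmaP sS; have /card_gt0P[i] : (0 < #|finset (fun i => s i == k)|)%N.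
  by rewrite sS.
by rewrite inE => /eqP; exists i.
Qed.

Lemma relabel_perm_inj s : (0 < n %/ K)%N -> s \in Sigma n K ->
  injective (fun p => relabel p s).
Proof.
move=> S0 sS p q /ffunP pq; apply/permP => k.
by have [i <-] := Sigma_onto k S0 sS; have := pq i; rewrite !ffunE.
Qed.

Lemma hamming_relabel p s t : hamming (relabel p s) (relabel p t) = hamming s t.
Proof.
by apply: eq_card => i; rewrite !inE !ffunE (inj_eq perm_inj).
Qed.

Lemma hammingC s t : hamming s t = hamming t s.
Proof. by apply: eq_card => i; rewrite !inE eq_sym. Qed.

Lemma hamming_le s t : (hamming s t <= n)%N.
Proof. by rewrite -[leqRHS](card_ord n) max_card. Qed.

Lemma hamming_eq0 s t : (hamming s t == 0%N) = (s == t).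
Proof.
rewrite cards_eq0; apply/eqP/eqP => [h|->]; last by apply/setP => i; rewrite !inE eqxx.
apply/ffunP => i; move/setP/(_ i): h; rewrite !inE.
by move/negbFE/eqP.
Qed.

Lemma hammingxx s : hamming s s = 0%N.
Proof. by apply/eqP; rewrite hamming_eq0. Qed.

Lemma orbit_dist_le p s t : (orbit_dist s t <= hamming (relabel p s) t)%N.
Proof. by rewrite /orbit_dist -minEnat; exact: (@bigmin_le _ nat). Qed.

Lemma orbit_dist_len s t : (orbit_dist s t <= n)%N.
Proof. exact: leq_trans (orbit_dist_le 1%g s t) (hamming_le _ _). Qed.

Lemma orbit_dist_attained s t : exists p, orbit_dist s t = hamming (relabel p s) t.
Proof.
exists (best_perm s t); apply/eqP; rewrite eqn_leq orbit_dist_le /=.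
rewrite /best_perm; case: arg_minnP => // p _ min_p; rewrite /orbit_dist.
by elim/big_ind: _ => [|x y px py|q _]; [exact: hamming_le|rewrite leq_min px|exact: min_p].
Qed.

Lemma orbit_dist_relabel p s t : orbit_dist (relabel p s) t = orbit_dist s t.
Proof.
apply/eqP; rewrite eqn_leq; apply/andP; split.
  have [q ->] := orbit_dist_attained s t.
  by rewrite -{2}(relabelK p s) -relabelM orbit_dist_le.
by have [q ->] := orbit_dist_attained (relabel p s) t; rewrite -relabelM orbit_dist_le.
Qed.

Lemma orbit_distC s t : orbit_dist s t = orbit_dist t s.
Proof.
suff H u v : (orbit_dist u v <= orbit_dist v u)%N by apply/eqP; rewrite eqn_leq !H.
have [p ->] := orbit_dist_attained v u.
rewrite -(hamming_relabel p^-1%g) relabelK hammingC; exact: orbit_dist_le.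
Qed.

Lemma lossE (R : realType) s t : loss s t = (orbit_dist s t)%:R / n%:R :> R.
Proof. by []. Qed.

Lemma canon_labelingP t s : let c := canon_labeling t s in
  [/\ exists q, c = relabel q s, hamming c t = orbit_dist s t
    & forall q, hamming (relabel q s) t = orbit_dist s t ->
        ((codom c : seqlexi 'I_K) <= codom (relabel q s))%O].
Proof.
have bestE : hamming (relabel (best_perm s t) s) t = orbit_dist s t.
  apply/eqP; rewrite eqn_leq orbit_dist_le andbT.
  have [p ->] := orbit_dist_attained s t.
  by rewrite /best_perm; case: arg_minnP => // q _; exact.
rewrite /= /canon_labeling; case: Order.TotalTheory.arg_minP => [|p].
  by rewrite inE eqxx.
rewrite inE bestE => /eqP pm pmin; split => //; first by exists p.
by move=> q qm; apply: pmin; rewrite inE bestE qm.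
Qed.

Lemma codom_ffun_inj : injective (fun s => codom s).
Proof.
move=> s t /= st; apply/ffunP => i.
by have := congr1 (fun v => nth (s i) v (enum_rank i)) st; rewrite !nth_codom enum_rankK.
Qed.

(** Both sides are lexicographically least among the members of one orbit closest to [t];
    antisymmetry identifies them although the minimizing permutations differ. *)
Lemma canon_labeling_relabel t p s :
  canon_labeling t (relabel p s) = canon_labeling t s.
Proof.
have [[q1 c1] h1 m1] := canon_labelingP t (relabel p s).
have [[q2 c2] h2 m2] := canon_labelingP t s.
rewrite orbit_dist_relabel in h1 m1.
apply: codom_ffun_inj; apply: (@Order.POrderTheory.le_anti _ (seqlexi 'I_K)).
apply/andP; split.
  have := m1 (p^-1 * q2)%g; rewrite relabelM relabelK -c2; exact.
have := m2 (p * q1)%g; rewrite relabelM -c1; exact.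
Qed.

Lemma canonical_hamming t s :
  s \in canonical_set t -> hamming s t = orbit_dist s t.
Proof.
by rewrite inE => /andP[_ /eqP <-]; have [[q ->] -> _] := canon_labelingP t s;
   rewrite orbit_dist_relabel.
Qed.

Lemma canonical_Sigma t s : s \in canonical_set t -> s \in Sigma n K.
Proof. by rewrite inE => /andP[]. Qed.

Lemma canon_labeling_canonical t s :
  s \in Sigma n K -> canon_labeling t s \in canonical_set t.
Proof.
move=> sS; have [[q cE] _ _] := canon_labelingP t s.
by rewrite finset.in_set cE relabel_Sigma sS canon_labeling_relabel -cE eqxx.
Qed.

Lemma canonical_self t : t \in Sigma n K -> t \in canonical_set t.
Proof.
move=> tS; rewrite finset.in_set tS /= -hamming_eq0.
have [_ -> _] := canon_labelingP t t.
by have := orbit_dist_le 1%g t t; rewrite relabel1 hammingxx leqn0.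
Qed.

(** With nonempty clusters every label occurs, so the action on [Sigma] is free and each orbit has
    one canonical member, reached by one permutation. *)
Lemma canonical_relabel t p s : (0 < n %/ K)%N ->
  s \in canonical_set t -> relabel p s \in canonical_set t -> p = 1%g.
Proof.
move=> S0; rewrite ![_ \in canonical_set _]finset.in_set => /andP[sS /eqP cs] /andP[_ /eqP].
rewrite canon_labeling_relabel cs => sp.
by apply: (@relabel_perm_inj s S0 sS p 1%g) => /=; rewrite relabel1 -sp.
Qed.

Definition common_pairs s t : nat :=
  \sum_i \sum_j ((s i == s j) && (t i == t j)).

Lemma sum_indicator (I : finType) (P : pred I) :
  (\sum_i (P i : nat) = #|finset P|)%N.
Proof.
by rewrite -sum1_card [RHS]big_mkcond /=; apply: eq_bigr => i _; rewrite inE; case: (P i).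
Qed.

Lemma hamming_agree s t :
  (\sum_(k < n) (s k == t k) + hamming s t = n)%N.
Proof.
rewrite sum_indicator -[RHS](card_ord n) -cardsT.
rewrite -(cardsID (finset (fun i => s i == t i)) [set: 'I_n]) finset.setTI.
by congr (_ + _)%N; apply: eq_card => i; rewrite !inE andbT.
Qed.

Definition overlap s t k l : nat := #|finset (fun i => (s i == k) && (t i == l))|.

Lemma sum_overlap s t (W : 'I_K -> 'I_K -> nat) :
  (\sum_k \sum_l overlap s t k l * W k l = \sum_i W (s i) (t i))%N.
Proof.
rewrite [RHS](partition_big s xpredT) //=; apply: eq_bigr => k _.
rewrite (partition_big t xpredT) //=; apply: eq_bigr => l _.
rewrite (eq_bigr (fun=> W k l)) => [|i /andP[/eqP-> /eqP->]//].
by rewrite sum_nat_const; congr (_ * _)%N; apply: eq_card => i; rewrite [RHS]unfold_in /= !inE.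
Qed.

Lemma overlap_regular s t : s \in Sigma n K -> t \in Sigma n K ->
  regular_mx (n %/ K) (overlap s t).
Proof.
move=> /SigmaP sS /SigmaP tS; split=> k; [rewrite -(sS k)|rewrite -(tS k)];
  rewrite -sum1_card.
  rewrite (partition_big t xpredT) //=; apply: eq_bigr => l _.
  by rewrite /overlap sum1_card; apply: eq_card => i; rewrite [RHS]unfold_in /= !inE.
rewrite (partition_big s xpredT) //=; apply: eq_bigr => l _.
by rewrite /overlap sum1_card; apply: eq_card => i; rewrite [RHS]unfold_in /= !inE andbC.
Qed.

(** The common pairs number the sum of the squared overlaps, so Birkhoff's bound applies with the
    overlap matrix also as weight: along a permutation [p] the overlaps count the agreements of
    [relabel p s] with [t]. *)
Lemma common_pairs_le s t : s \in Sigma n K -> t \in Sigma n K ->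
  (common_pairs s t <= (n %/ K) * (n - orbit_dist s t))%N.
Proof.
move=> sS tS.
have -> : common_pairs s t = (\sum_k \sum_l overlap s t k l * overlap s t k l)%N.
  rewrite sum_overlap; apply: eq_bigr => i _; rewrite sum_indicator.
  by apply: eq_card => j; rewrite !inE [s j == _]eq_sym [t j == _]eq_sym.
apply: regular_mx_bound (overlap_regular sS tS) _ => p.
have -> : (\sum_k overlap s t k (p k) = \sum_(i < n) (relabel p s i == t i))%N.
  rewrite sum_indicator -[RHS]sum1_card (partition_big s xpredT) //=.
  apply: eq_bigr => k _; rewrite /overlap sum1_card; apply: eq_card => i; rewrite [RHS]unfold_in /= !inE ffunE.
  by rewrite andbC; case: (eqVneq (s i) k) => [->|]; rewrite ?andbF // !andbT eq_sym.
by have := hamming_agree (relabel p s) t; have := orbit_dist_le p s t; lia.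
Qed.

Lemma common_pairs_self s : s \in Sigma n K ->
  common_pairs s s = (n * (n %/ K))%N.
Proof.
move=> /SigmaP sS; rewrite /common_pairs (eq_bigr (fun=> (n %/ K)%N)) => [|i _].
  by rewrite sum_nat_const card_ord.
by rewrite -(sS (s i)) sum_indicator; apply: eq_card => j; rewrite !inE andbb eq_sym.
Qed.

End LabelingTheory.

(** * The capped score and the gap given by the certificate *)

Section Scores.
Variables (R : realType) (n K : nat).
Implicit Types (A : graph n) (X Y Z : 'M[R]_n) (s t : labeling n K) (D lam : R).

Lemma cluster_mx_relabel p s : cluster_mx R (relabel p s) = cluster_mx R s.
Proof. by apply/matrixP => i j; rewrite !mxE !ffunE (inj_eq perm_inj). Qed.

Lemma Tscore_relabel lam A D p s :
  Tscore lam A D (relabel p s) = Tscore lam A D s.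
Proof. by rewrite /Tscore cluster_mx_relabel. Qed.

Lemma common_pairsE s t :
  (common_pairs s t)%:R = \sum_i \sum_j cluster_mx R s i j * cluster_mx R t i j.
Proof.
rewrite /common_pairs natr_sum; apply: eq_bigr => i _; rewrite natr_sum.
by apply: eq_bigr => j _; rewrite !mxE -natrM mulnb.
Qed.

Lemma l1norm_cluster s t : l1norm (cluster_mx R s - cluster_mx R t) =
  (common_pairs s s)%:R + (common_pairs t t)%:R - 2 * (common_pairs s t)%:R.
Proof.
rewrite !common_pairsE mulr_sumr -sumrN -!big_split /=; apply: eq_bigr => i _.
rewrite mulr_sumr -sumrN -!big_split /=; apply: eq_bigr => j _; rewrite !mxE.
case: (s i == s j); case: (t i == t j); rewrite ?mulr1n ?mulr0n ?subrr ?subr0 ?sub0r ?normrN ?normr0 ?normr1; ring.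
Qed.

Lemma l1norm_cluster_ge s t : s \in Sigma n K -> t \in Sigma n K ->
  2 * (n %/ K)%:R * (orbit_dist s t)%:R <= l1norm (cluster_mx R s - cluster_mx R t).
Proof.
move=> sS tS; rewrite l1norm_cluster !common_pairs_self //.
have := common_pairs_le sS tS; rewrite -(ler_nat R) natrM natrB ?orbit_dist_len //.
by rewrite natrM => H; lra.
Qed.

Lemma cluster_mx_ge0 s i j : 0 <= cluster_mx R s i j.
Proof. by rewrite mxE ler0n. Qed.

Lemma cluster_mx_rowsum s i : s \in Sigma n K ->
  \sum_j cluster_mx R s i j = (n %/ K)%:R.
Proof.
move=> /SigmaP sS; rewrite -(sS (s i)).
under eq_bigr do rewrite mxE.
rewrite -natr_sum sum_indicator; congr _%:R; apply: eq_card => j.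
by rewrite !inE eq_sym.
Qed.

Lemma cluster_cert_set s : s \in Sigma n K -> cert_set K (cluster_mx R s).
Proof.
move=> sS; split=> [|i|i j|i]; last exact: cluster_mx_rowsum.
- split; first by apply/matrixP => i j; rewrite !mxE eq_sym.
  pose B : 'M[R]_(n, K) := \matrix_(i, k) (s i == k)%:R.
  have -> : cluster_mx R s = B *m B^T.
    apply/matrixP => i j; rewrite !mxE (bigD1 (s i)) //= !mxE eqxx mul1r eq_sym.
    by rewrite big1 ?addr0 // => k /negPf ki; rewrite !mxE [s i == k]eq_sym ki mul0r.
  move=> v; rewrite mulmxA -mulmxA -[X in X *m _]trmxK trmx_mul trmxK mxE.
  apply: sumr_ge0 => k _; rewrite [X in X * _]mxE; exact: sqr_ge0.
- by rewrite mxE eqxx.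
- exact: cluster_mx_ge0.
Qed.

Lemma score_obj_ge0 A D Y q z : 0 <= D -> (forall i j, 0 <= Y i j) ->
  score_feasible A q z -> 0 <= score_obj A D Y q z.
Proof.
move=> D0 Y0 [q01 zf]; apply: addr_ge0; last first.
  by apply: mulr_ge0 => //; apply: sumr_ge0 => i _; have /andP[] := q01 i.
apply: sumr_ge0 => i _; apply: sumr_ge0 => j /andP[ij Aij].
by have [/andP[z0 _] _] := zf i j ij Aij; apply: mulr_ge0.
Qed.

Lemma Hscore_le A D Y q z : 0 <= D -> (forall i j, 0 <= Y i j) ->
  score_feasible A q z -> Hscore A D Y <= score_obj A D Y q z.
Proof.
move=> D0 Y0 f; apply: ge_inf; last by exists q, z.
by exists 0 => _ [q' [z' [f' ->]]]; exact: score_obj_ge0.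
Qed.

Definition raw_score A Y : R :=
  \sum_(i : 'I_n) \sum_(j : 'I_n | (i < j)%N && adj A i j) Y i j.

Lemma Hscore_le_raw A D Y : 0 <= D -> (forall i j, 0 <= Y i j) ->
  Hscore A D Y <= raw_score A Y.
Proof.
move=> D0 Y0; pose q0 := fun _ : 'I_n => 0 : R.
have f : score_feasible A q0 (const_mx 1).
  split=> [i|i j _ _]; rewrite /q0 /= ?mxE ?lexx ?ler01 //; split=> //; lra.
apply: le_trans (Hscore_le D0 Y0 f) _; rewrite /score_obj [X in _ * X]big1 // mulr0 addr0.
by apply: ler_sum => i _; apply: ler_sum => j _; rewrite mxE mul1r.
Qed.

Lemma Hscore_le_cap A D Y : 0 <= D -> (forall i j, 0 <= Y i j) ->
  Hscore A D Y <= D * n%:R.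
Proof.
move=> D0 Y0; pose q1 := fun _ : 'I_n => 1 : R.
have f : score_feasible A q1 0.
  split=> [i|i j _ _]; rewrite /q1 /= ?mxE ?lexx ?ler01 //; split=> //; lra.
apply: le_trans (Hscore_le D0 Y0 f) _; rewrite /score_obj big1 ?add0r => [|i _].
  by rewrite sumr_const card_ord.
by apply: big1 => j _; rewrite mxE mul0r.
Qed.

Lemma score_feasible_exists A : exists q : 'I_n -> R, exists z, score_feasible A q z.
Proof.
exists (fun=> 0), (const_mx 1); split=> [i|i j _ _]; rewrite /= ?mxE ?lexx ?ler01 //; split=> //; lra.
Qed.

Lemma cert_set_total Y : cert_set K Y -> \sum_i \sum_j Y i j = n%:R * (n %/ K)%:R.
Proof.
by case=> _ _ _ rY; rewrite (eq_bigr _ (fun i _ => rY i)) sumr_const card_ord mulr_natl.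
Qed.

(** A member lies below [sup] only once the set is known to be bounded above. Deleting every vertex
    bounds the capped score by [D * n%:R]; the total mass of certificate matrices controls the
    penalty and the norm. *)
Lemma Vcert_ge lam A D theta Y t : 0 <= D -> 0 <= theta -> t \in Sigma n K ->
  cert_set K Y ->
  Psi lam A D Y + theta / n%:R * l1norm (Y - cluster_mx R t)
    <= Vcert K lam A D theta (cluster_mx R t).
Proof.
move=> D0 th0 tS cY; apply: ub_le_sup; last by exists Y.
pose B : R := n%:R * (n %/ K)%:R.
exists (D * n%:R + `|lam| * B + theta / n%:R * (B + B)) => _ [X cX ->].
have [_ _ X0 _] := cX.
apply: lerD; last first.
  apply: ler_wpM2l; first by rewrite divr_ge0.
  rewrite /B -{1}(cert_set_total cX) -(cert_set_total (cluster_cert_set tS)) -big_split.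
  apply: ler_sum => i _; rewrite -big_split; apply: ler_sum => j _ /=.
  by rewrite !mxE (le_trans (ler_normB _ _)) // !ger0_norm ?ler0n.
apply: lerD; first exact: Hscore_le_cap.
set U := \sum_i _; have U0 : 0 <= U.
  by apply: sumr_ge0 => i _; apply: sumr_ge0 => j _.
have UB : U <= B.
  rewrite /B -(cert_set_total cX); apply: ler_sum => i _.
  rewrite big_mkcond; apply: ler_sum => j _; by case: ifP.
rewrite -mulNr; apply: le_trans (ler_norm _) _; rewrite normrM normrN.
by rewrite (ger0_norm U0) ler_wpM2l.
Qed.

Lemma certified_gap lam A D theta s t : 0 <= D -> 0 <= theta ->
  s \in Sigma n K -> t \in Sigma n K -> certified lam D theta A t ->
  Tscore lam A D s + theta / n%:R * l1norm (cluster_mx R s - cluster_mx R t)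
    <= Tscore lam A D t.
Proof.
move=> D0 th0 sS tS /eqP cert; rewrite [X in _ <= X]/Tscore -cert.
exact: Vcert_ge (cluster_cert_set sS).
Qed.

End Scores.

(** * Uniform relabeling of a law carried by canonical labelings *)

Section Shuffle.
Variables (R : realType) (n K : nat).
Implicit Types (s t : labeling n K) (P Q f : labeling n K -> R).

Lemma shuffleE P t :
  shuffle P t = #|{perm 'I_K}|%:R^-1 * \sum_p P (relabel p^-1%g t).
Proof.
rewrite /shuffle mulr_sumr; apply: eq_bigr => p _.
rewrite (bigD1 (relabel p^-1%g t)) //= relabelVK eqxx mulr1 big1 ?addr0 // => s st.
rewrite [_ == t](_ : _ = false) ?mulr0 //; apply/eqP => pt.
by rewrite -pt relabelK eqxx in st.
Qed.

Lemma ler_shuffle P Q t : (forall s, P s <= Q s) -> shuffle P t <= shuffle Q t.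
Proof.
by move=> PQ; rewrite !shuffleE ler_wpM2l ?invr_ge0 ?ler0n // ler_sum.
Qed.

Hypothesis S_gt0 : (0 < n %/ K)%N.
Variable u : labeling n K.

(** The orbit of [t] meets [canonical_set u] in one labeling, reached by one permutation, so a
    single summand survives. *)
Lemma sum_canonical_relabel f t : t \in Sigma n K -> (forall p s, f (relabel p s) = f s) ->
  \sum_(p : {perm 'I_K}) (if relabel p^-1%g t \in canonical_set u then
    f (relabel p^-1%g t) else 0) = f t.
Proof.
move=> tS finv; have [[q cE] _ _] := canon_labelingP u t.
have cR := canon_labeling_canonical u tS.
rewrite (bigD1 q^-1%g) //= invgK -cE cR cE finv big1 ?addr0 // => p pq.
case: ifPn => // pR; case/eqP: pq.
have tE : t = relabel q^-1%g (canon_labeling u t) by rewrite cE relabelK.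
move: pR; rewrite {1}tE -relabelM => pR.
have /eqP := canonical_relabel S_gt0 cR pR.
by rewrite -invMg eq_invg1 mulg_eq1 => /eqP.
Qed.

Lemma shuffle_canonical f t : (forall p s, f (relabel p s) = f s) ->
  shuffle (fun s => if s \in canonical_set u then f s else 0) t
    = if t \in Sigma n K then #|{perm 'I_K}|%:R^-1 * f t else 0.
Proof.
move=> finv; rewrite shuffleE; case: ifPn => tS.
  by rewrite sum_canonical_relabel.
rewrite big1 ?mulr0 // => p _; case: ifP => // /canonical_Sigma.
by rewrite relabel_Sigma (negPf tS).
Qed.

Lemma sum_Sigma_canonical f : (forall p s, f (relabel p s) = f s) ->
  \sum_(t in Sigma n K) f t = #|{perm 'I_K}|%:R * \sum_(s in canonical_set u) f s.
Proof.
move=> finv; rewrite (eq_bigr _ (fun t tS => esym (sum_canonical_relabel tS finv))).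
rewrite exchange_big /= (eq_bigr (fun=> \sum_(s in canonical_set u) f s)) => [|p _].
  by rewrite sumr_const mulr_natl.
rewrite -big_mkcondr /= [RHS](reindex_inj (@relabel_inj n K p^-1%g)) /=.
apply: eq_bigl => t; rewrite andb_idl // => /canonical_Sigma.
by rewrite relabel_Sigma.
Qed.
End Shuffle.

(** * Truncated rejection sampling against the Gibbs law *)

Lemma rbar_bounds (R : realType) M : 0 <= rbar R M <= 1.
Proof.
have e0 : expR (- (1 / 4)) <= 1 :> R by rewrite expR_le1; lra.
have e1 := @expR_ge0 R (- (1 / 4)).
by apply/andP; split; [apply: exprn_ge0; lra|apply: exprn_ile1; lra].
Qed.

Lemma expR_xi_ge (R : realType) M : 1 + (expR (1 / 4) - 1) * rbar R M <= expR (xi R M).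
Proof.
have /andP[r0 _] := rbar_bounds R M.
have e1 := expR_ge1Dx (1 / 4 : R).
have p0 : 0 <= (expR (1 / 4) - 1) * rbar R M by apply: mulr_ge0 => //; lra.
rewrite -[leLHS]lnK; last by rewrite posrE; lra.
by rewrite ler_expR /xi le_max lexx orbT.
Qed.

Section Algorithm.
Variables (R : realType) (n K : nat).
Variables (lam eps D theta : R) (M : nat) (A : graph n) (u : labeling n K).
Hypotheses (n_gt0 : (0 < n)%N) (K_gt1 : (1 < K)%N) (Kn : (K %| n)%N).
Hypotheses (eps_gt0 : 0 < eps) (D_gt0 : 0 < D) (theta_ge0 : 0 <= theta).
Hypothesis kappa_ge : ln (4 * n%:R * (K%:R - 1)) <= kappa K eps D theta.
Hypothesis uS : u \in Sigma n K.
Implicit Types s t : labeling n K.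

Local Notation eta := (gibbs_eta eps D).
Local Notation kap := (kappa K eps D theta).
Local Notation T := (Tscore lam A D).
Local Notation w s := (expR (eta * T s)).
Local Notation ru := (canonical_set u).
Local Notation prop := (proposal eps D theta u).
Local Notation accw := (accept_weight lam eps D theta A u).
Local Notation acc := (accept_prob lam eps D theta A u).
Local Notation rej := (reject_prob lam eps D theta A u).

Lemma cluster_size_gt0 : (0 < n %/ K)%N.
Proof. by rewrite divn_gt0 ?(ltnW K_gt1) // (dvdn_leq n_gt0 Kn). Qed.

Lemma gibbs_eta_gt0 : 0 < eta.
Proof. by rewrite divr_gt0 // mulr_gt0. Qed.

(** On canonical labelings the Hamming distance is the orbit distance m, so the certificate gap is
    at least (theta / n) 2 (n / K) m. Multiplied by eta this is exactly kappa m, the bonus in the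
    acceptance weight. *)
Lemma accept_weight_le1 s : certified lam D theta A u -> s \in ru -> accw s <= 1.
Proof.
move=> cert sR; have sS := canonical_Sigma sR.
have gap := certified_gap (ltW D_gt0) theta_ge0 sS uS cert.
have l1 := l1norm_cluster_ge R sS uS.
rewrite -expR0 ler_expR (canonical_hamming sR) /kappa.
set m := (orbit_dist s u)%:R in l1 *.
have nE : n%:R = (n %/ K)%:R * K%:R :> R by rewrite -natrM divnK.
have S0 : 0 < (n %/ K)%:R :> R by rewrite ltr0n cluster_size_gt0.
have K0 : 0 < K%:R :> R by rewrite ltr0n ltnW.
have step : theta / n%:R * (2 * (n %/ K)%:R * m) <= T u - T s.
  apply: le_trans (_ : theta / n%:R * l1norm (cluster_mx R s - cluster_mx R u) <= _).
    by rewrite ler_wpM2l // divr_ge0.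
  by move: gap; lra.
have -> : 2 * eta * theta / K%:R * m = eta * (theta / n%:R * (2 * (n %/ K)%:R * m)).
  by rewrite nE; field; rewrite !gt_eqF.
rewrite -mulrDr pmulr_rle0 ?gibbs_eta_gt0 //; move: step; lra.
Qed.

Local Notation c := (1 + (K%:R - 1) * expR (- kap)).

Lemma K1_gt0 : 0 < K%:R - 1 :> R.
Proof. by rewrite subr_gt0 ltr1n. Qed.

Lemma norm_gt0 : 0 < c.
Proof.
by apply: addr_gt0 => //; apply: mulr_gt0; [exact: K1_gt0|exact: expR_gt0].
Qed.

Lemma proposal_ge0 s : 0 <= prop s.
Proof.
apply: prodr_ge0 => i _; apply: divr_ge0; last exact: ltW norm_gt0.
by case: ifP => // _; exact: expR_ge0.
Qed.

Lemma proposalE s : prop s = expR (- kap * (hamming s u)%:R) / c ^+ n.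
Proof.
rewrite /proposal big_split /= prodr_const card_ord exprVn; congr (_ * _).
rewrite (bigID (fun i => s i == u i)) /= big1 ?mul1r => [|i ->//].
rewrite (eq_bigr (fun=> expR (- kap))) => [|i /negPf->//].
rewrite prodr_const -expRM_natr; congr (expR (_ * _%:R)).
by apply: eq_card => i; rewrite [RHS]inE unfold_in.
Qed.

Lemma sum_proposal : \sum_s prop s = 1.
Proof.
rewrite /proposal.
rewrite -(bigA_distr_bigA (fun i k => (if k == u i then 1 else expR (- kap)) / c)).
apply: big1 => i _; rewrite -mulr_suml (bigD1 (u i)) //= eqxx.
rewrite (eq_bigr (fun=> expR (- kap))) => [|k /negPf->//].
rewrite sumr_const cardC1 card_ord -[_ *+ _.-1]mulr_natl -subn1 natrB ?(ltnW K_gt1) //.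
by rewrite divff // gt_eqF // norm_gt0.
Qed.

(** The lower bound on kappa gives (K - 1) e^(-kappa) <= 1 / (4n), and (1 + 1/(4n))^n <= e^(1/4). *)
Lemma normX_le : c ^+ n <= expR (1 / 4).
Proof.
have n0 : 0 < n%:R :> R by rewrite ltr0n.
have K1 := K1_gt0.
have e : (K%:R - 1) * expR (- kap) <= (4 * n%:R)^-1.
  have -> : (4 * n%:R)^-1 = (K%:R - 1) * (4 * n%:R * (K%:R - 1))^-1 :> R.
    by field; rewrite !gt_eqF //= mulrC.
  rewrite ler_wpM2l ?(ltW K1) // expRN lef_pV2 ?posrE ?expR_gt0 ?mulr_gt0 //.
  by rewrite -[leLHS]lnK ?ler_expR // posrE !mulr_gt0.
have -> : 1 / 4 = (4 * n%:R)^-1 * n%:R :> R by field; rewrite gt_eqF.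
rewrite expRM_natr lerXn2r ?nnegrE ?expR_ge0 ?(ltW norm_gt0) //.
by apply: le_trans (expR_ge1Dx _); rewrite lerD2l.
Qed.

Lemma accept_prob_bounds s : 0 <= acc s <= 1.
Proof.
by rewrite /accept_prob; case: ifP => _; rewrite ?lexx ?ler01 // le_min ge_min ler01 lexx expR_ge0.
Qed.

Lemma reject_ge0 : 0 <= rej.
Proof.
apply: sumr_ge0 => s _; apply: mulr_ge0; first exact: proposal_ge0.
by have /andP[_] := accept_prob_bounds s; rewrite subr_ge0.
Qed.

Lemma rejectE : rej = 1 - \sum_s prop s * acc s.
Proof.
rewrite -sum_proposal -sumrB; apply: eq_bigr => s _; ring.
Qed.

Section Certified.
Hypothesis cert : certified lam D theta A u.

Lemma proposal_accept s :
  prop s * acc s = if s \in ru then (c ^+ n)^-1 * (w s / w u) else 0.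
Proof.
rewrite /accept_prob; case: ifP => [sR|]; last by rewrite mulr0.
rewrite min_r; last exact: accept_weight_le1.
rewrite proposalE mulrAC mulrC; congr (_ * _).
by rewrite -expRD -expRN -expRD; congr expR; ring.
Qed.

Local Notation W := (\sum_(s in ru) w s).

Lemma canonical_sum_gt0 : 0 < W.
Proof.
rewrite (bigD1 u) ?canonical_self //= ltr_pwDl ?expR_gt0 //.
by apply: sumr_ge0 => s _; exact: expR_ge0.
Qed.

Lemma acceptE : 1 - rej = (c ^+ n)^-1 * (W / w u).
Proof.
rewrite rejectE subKr (eq_bigr _ (fun s _ => proposal_accept s)) -big_mkcond /=.
by rewrite -mulr_sumr -mulr_suml.
Qed.

Lemma cnX_gt0 : 0 < c ^+ n.
Proof. by rewrite exprn_gt0 // norm_gt0. Qed.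

(** The acceptance probability of one trial is (W / w u) / c^n; being at most 1, it bounds W / w u
    by c^n. *)
Lemma center_ratio : W / w u <= expR (1 / 4).
Proof.
have := reject_ge0; have -> : rej = 1 - (c ^+ n)^-1 * (W / w u).
  by rewrite -acceptE subKr.
rewrite subr_ge0 mulrC ler_pdivrMr ?cnX_gt0 // [1 * _ ^+ _]mul1r => /le_trans; apply.
exact: normX_le.
Qed.

Lemma reject_le : rej <= 1 - expR (- (1 / 4)).
Proof.
have := acceptE; suff : expR (- (1 / 4)) <= (c ^+ n)^-1 * (W / w u) by lra.
have p0 : expR (- (1 / 4)) <= (c ^+ n)^-1.
  by rewrite [leLHS]expRN lef_pV2 ?posrE ?expR_gt0 ?cnX_gt0 ?normX_le.
have W1 : 1 <= W / w u.
  rewrite ler_pdivlMr ?expR_gt0 // mul1r (bigD1 u) ?canonical_self //= lerDl.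
  by apply: sumr_ge0 => s _; exact: expR_ge0.
apply: le_trans p0 _; rewrite ler_peMr ?invr_ge0 ?(ltW cnX_gt0) //.
Qed.

(** Acceptance within m trials yields the Gibbs law on canonical labelings with mass 1 - rej^m; the
    remaining rej^m sits at [u]. The density is thus largest at [u], where the factor is (1 - rej^m)
    + rej^m W / w u. *)
Lemma trials_le m s : trials lam eps D theta A u m s <=
  if s \in ru then (1 + (W / w u - 1) * rej ^+ m) * (w s / W) else 0.
Proof.
have W0 := canonical_sum_gt0; have wu := expR_gt0 (eta * T u).
elim: m => [|m IH] /=.
  have -> : 1 + (W / w u - 1) * rej ^+ 0 = W / w u by rewrite expr0; ring.
  case: eqP => [->|_].
    rewrite canonical_self //= le_eqVlt; apply/orP; left.
    by apply/eqP; rewrite mulr1n; field; rewrite !gt_eqF.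
  by case: ifP => // _; rewrite !mulr_ge0 ?invr_ge0 ?expR_ge0 ?(ltW W0).
apply: le_trans (lerD (lexx _) (ler_wpM2l reject_ge0 IH)) _.
rewrite proposal_accept; case: ifP => _; last by rewrite mulr0 addr0.
have -> : (c ^+ n)^-1 * (w s / w u) = (1 - rej) * (w s / W).
  by rewrite acceptE; field; rewrite !gt_eqF // cnX_gt0.
rewrite exprS le_eqVlt; apply/orP; left; apply/eqP; ring.
Qed.

End Certified.

Lemma gibbs_ge0 t : 0 <= gibbs lam eps D A t.
Proof.
rewrite /gibbs; case: ifP => // _; rewrite divr_ge0 ?expR_ge0 //.
by apply: sumr_ge0 => s _; exact: expR_ge0.
Qed.

(** The shuffle spreads the canonical Gibbs law over whole orbits, and invariance of the score makes
    the result [gibbs]. The factor of [trials_le] is at most the second entry of the maximum in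
    [xi]. *)
Lemma trunc_law_le t :
  trunc_law lam eps D theta M A u t <= expR (xi R M) * gibbs lam eps D A t.
Proof.
have e1 := expR_ge1Dx (1 / 4 : R).
have xige := expR_xi_ge R M; have /andP[r0 _] := rbar_bounds R M.
rewrite /trunc_law; case: ifP => cert; last first.
  rewrite -[leLHS]mul1r ler_wpM2r ?gibbs_ge0 //; apply: le_trans xige.
  by rewrite lerDl mulr_ge0 //; lra.
have W0 := canonical_sum_gt0.
set W := \sum_(s in ru) _ in W0.
pose f s := expR (xi R M) * (w s / W).
apply: le_trans (_ : shuffle (fun s => if s \in ru then f s else 0) t <= _).
  apply: ler_shuffle => s; apply: le_trans (trials_le cert M s) _.
  case: ifP => // _; rewrite /f ler_wpM2r ?divr_ge0 ?expR_ge0 ?(ltW W0) //.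
  apply: le_trans xige; rewrite lerD2l.
  have rM : rej ^+ M <= rbar R M.
    have rle := reject_le cert; have rge := reject_ge0.
    by rewrite /rbar lerXn2r ?nnegrE //; apply: le_trans rge rle.
  apply: le_trans (_ : (expR (1 / 4) - 1) * rej ^+ M <= _).
    by rewrite ler_wpM2r ?exprn_ge0 ?reject_ge0 // lerD2r center_ratio.
  by rewrite ler_wpM2l // subr_ge0; lra.
rewrite shuffle_canonical ?cluster_size_gt0 // => [|p s]; last first.
  by rewrite /f Tscore_relabel.
rewrite /gibbs; case: ifP => _; last by rewrite mulr0.
rewrite (@sum_Sigma_canonical R n K cluster_size_gt0 u (fun s => w s)) => [|p s].
  have : 0 < #|{perm 'I_K}|%:R :> R.
    by rewrite ltr0n; apply/card_gt0P; exists 1%g.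
  move: W0; rewrite -/W /f => W0 P0; rewrite le_eqVlt; apply/orP; left; apply/eqP.
  by field; rewrite !gt_eqF.
by rewrite Tscore_relabel.
Qed.

End Algorithm.

(** * Risk of the Gibbs law on a fixed graph *)

Section GibbsRisk.
Variables (R : realType) (n K : nat).
Implicit Types (A : graph n) (s t : labeling n K) (D lam : R).

Lemma sum_upper (F : 'I_n -> 'I_n -> R) :
  \sum_i \sum_j F i j =
  \sum_i F i i + \sum_(i : 'I_n) \sum_(j : 'I_n | (i < j)%N) (F i j + F j i).
Proof.
have -> : \sum_(i : 'I_n) \sum_(j : 'I_n | (i < j)%N) (F i j + F j i) =
    \sum_(i : 'I_n) \sum_(j : 'I_n | (i < j)%N) F i j +
    \sum_(i : 'I_n) \sum_(j : 'I_n | (j < i)%N) F i j.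
  rewrite [X in _ + X](exchange_big_dep xpredT) //= -big_split.
  by apply: eq_bigr => i _; rewrite -big_split.
rewrite -!big_split; apply: eq_bigr => i _ /=.
rewrite (bigD1 i) //= (bigID (fun j : 'I_n => (i < j)%N)) /=; congr (_ + (_ + _)).
  by apply: eq_bigl => j; rewrite -val_eqE /=; lia.
by apply: eq_bigl => j; rewrite -val_eqE /=; lia.
Qed.

Lemma adj_sym A i j : adj A i j = adj A j i.
Proof.
by have /andP[/eqP/matrixP/(_ j i)] := valP A; rewrite mxE.
Qed.

Lemma adj_irr A i : adj A i i = false.
Proof.
by have /andP[_ /forallP/(_ i)/negPf] := valP A.
Qed.

Lemma cluster_mx_sym s i j : cluster_mx R s i j = cluster_mx R s j i.
Proof. by rewrite !mxE eq_sym. Qed.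

Lemma cluster_mxxx s i : cluster_mx R s i i = 1.
Proof. by rewrite mxE eqxx. Qed.

Lemma upper_sum_sym (F : 'I_n -> 'I_n -> R) : (forall i j, F i j = F j i) ->
  \sum_(i : 'I_n) \sum_(j : 'I_n | (i < j)%N) F i j =
  (\sum_i \sum_j F i j - \sum_i F i i) / 2.
Proof.
move=> Fsym; rewrite sum_upper addrAC subrr add0r.
rewrite -[LHS](mulfK (_ : 2 != 0)) ?pnatr_eq0 //; congr (_ / _).
rewrite mulr_suml; apply: eq_bigr => i _; rewrite mulr_suml; apply: eq_bigr => j _.
by rewrite -(Fsym i j); ring.
Qed.

Lemma cluster_upper_sum s : s \in Sigma n K ->
  \sum_(i : 'I_n) \sum_(j : 'I_n | (i < j)%N) cluster_mx R s i j =
  (n%:R * (n %/ K)%:R - n%:R) / 2.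
Proof.
move=> sS; rewrite upper_sum_sym; last exact: cluster_mx_sym.
rewrite (cert_set_total (cluster_cert_set R sS)).
by rewrite (eq_bigr _ (fun i _ => cluster_mxxx s i)) sumr_const card_ord.
Qed.

Definition cluster_degree A s (i : 'I_n) : R :=
  \sum_j (adj A i j)%:R * cluster_mx R s i j.

(* This dominates the part of the degrees above the cap D, which is all that
   the fractional vertex deletions can remove from the raw score. *)
Definition degree_excess A D s : R := \sum_i expR (cluster_degree A s i - D).

Lemma degree_excess_ge0 A D s : 0 <= degree_excess A D s.
Proof. by apply: sumr_ge0 => i _; exact: expR_ge0. Qed.

Lemma raw_scoreE A (Y : 'M[R]_n) : raw_score A Y =
  \sum_(i : 'I_n) \sum_(j : 'I_n | (i < j)%N) (adj A i j)%:R * Y i j.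
Proof.
apply: eq_bigr => i _; rewrite big_mkcondr /=; apply: eq_bigr => j _.
by case: adj; rewrite ?mul1r ?mul0r.
Qed.

Lemma cluster_degree_sum A s (q : 'I_n -> R) :
  \sum_i q i * cluster_degree A s i =
  \sum_(i : 'I_n) \sum_(j : 'I_n | (i < j)%N)
    (q i + q j) * ((adj A i j)%:R * cluster_mx R s i j).
Proof.
under eq_bigr do rewrite mulr_sumr.
rewrite sum_upper big1 ?add0r => [|i _]; last by rewrite adj_irr mul0r mulr0.
apply: eq_bigr => i _; apply: eq_bigr => j _.
by rewrite [adj A j i]adj_sym [cluster_mx _ _ j i]cluster_mx_sym; ring.
Qed.

(** Since z >= 1 - q_i - q_j on edges, a feasible pair loses at most the sum of q_i (d_i - D) from
    the raw score, and q (d - D) <= e^(d - D) for q in [0, 1]. *)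
Lemma Hscore_ge A D s :
  raw_score A (cluster_mx R s) - degree_excess A D s <= Hscore A D (cluster_mx R s).
Proof.
apply: lb_le_inf.
  have [q [z f]] := score_feasible_exists R A.
  by exists (score_obj A D (cluster_mx R s) q z), q, z.
move=> _ [q [z [[q01 zf] ->]]].
have H1 : raw_score A (cluster_mx R s) - \sum_i q i * cluster_degree A s i <=
    \sum_(i : 'I_n) \sum_(j : 'I_n | (i < j)%N && adj A i j) z i j * cluster_mx R s i j.
  rewrite cluster_degree_sum raw_scoreE -sumrB; apply: ler_sum => i _.
  rewrite -sumrB [leRHS]big_mkcondr /=; apply: ler_sum => j ij.
  case: ifP => Aij; last by rewrite !mul0r mulr0 subr0.
  have [_ zq] := zf i j ij Aij.
  have := ler_wpM2r (cluster_mx_ge0 R s i j) zq.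
  by rewrite mul1r; lra.
have H2 : \sum_i q i * cluster_degree A s i <= degree_excess A D s + D * \sum_i q i.
  rewrite /degree_excess mulr_sumr -big_split /=; apply: ler_sum => i _.
  have /andP[q0 q1] := q01 i; set d := cluster_degree A s i.
  have e1 := expR_ge1Dx (d - D); have e0 := expR_ge0 (d - D).
  have : q i * (d - D) <= expR (d - D).
    have [dD|dD] := lerP 0 (d - D); last by have : q i * (d - D) <= 0; [nra|lra].
    by have : q i * (d - D) <= 1 * (d - D); [rewrite ler_wpM2r|lra].
  by rewrite mulrBr; lra.
by rewrite /score_obj; lra.
Qed.

(** The penalty cancels because balanced labelings all join equally many pairs. Capping only lowers
    the score of [t], so a degree excess is paid for [s] alone. *)
Lemma Tscore_diff_le lam A D s t : 0 <= D -> s \in Sigma n K -> t \in Sigma n K ->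
  Tscore lam A D t - Tscore lam A D s <=
  raw_score A (cluster_mx R t) - raw_score A (cluster_mx R s) + degree_excess A D s.
Proof.
move=> D0 sS tS; rewrite /Tscore /Psi !cluster_upper_sum //.
have := Hscore_le_raw A D0 (cluster_mx_ge0 R t).
have := Hscore_ge A D s; lra.
Qed.

Section Risk.
Variables (lam eps D : R) (A : graph n).
Hypotheses (S_gt0 : (0 < n %/ K)%N) (n_gt0 : (0 < n)%N).
Hypotheses (eps_gt0 : 0 < eps) (D_gt0 : 0 < D).
Local Notation eta := (gibbs_eta eps D).
Local Notation T := (Tscore lam A D).
Local Notation KF := (#|{perm 'I_K}|%:R : R).

Lemma perm_count_gt0 : 0 < KF.
Proof. by rewrite ltr0n; apply/card_gt0P; exists 1%g. Qed.

Lemma gibbs_weight_gt0 s : s \in Sigma n K ->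
  KF * expR (eta * T s) <= \sum_(t in Sigma n K) expR (eta * T t).
Proof.
move=> sS; rewrite (@sum_Sigma_canonical R n K S_gt0 s (fun t => expR (eta * T t))).
  rewrite ler_wpM2l ?ler0n // (bigD1 s) ?canonical_self //= lerDl.
  by apply: sumr_ge0 => t _; exact: expR_ge0.
by move=> p t; rewrite Tscore_relabel.
Qed.

(* Only the orbit of s is kept in the partition function. *)
Lemma gibbs_le s t : s \in Sigma n K ->
  gibbs lam eps D A t <= KF^-1 * expR (eta * (T t - T s)).
Proof.
move=> sS; have P0 := perm_count_gt0; have w0 := expR_gt0 (eta * T s).
rewrite /gibbs; case: ifP => _; last by rewrite mulr_ge0 ?expR_ge0 // invr_ge0 ltW.
rewrite (mulrBr eta (T t)) expRD expRN [leRHS]mulrCA ler_wpM2l ?expR_ge0 // -invfM lef_pV2 ?posrE.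
- exact: gibbs_weight_gt0.
- exact: lt_le_trans (mulr_gt0 P0 w0) (gibbs_weight_gt0 sS).
- exact: mulr_gt0.
Qed.

Lemma sum_gibbs_le1 s : s \in Sigma n K -> \sum_(t : labeling n K) gibbs lam eps D A t <= 1.
Proof.
move=> sS; rewrite /gibbs -big_mkcond /= -mulr_suml divff // gt_eqF //.
by apply: lt_le_trans (gibbs_weight_gt0 sS); rewrite mulr_gt0 ?perm_count_gt0 ?expR_gt0.
Qed.

Lemma loss_le1 s t : loss s t <= 1 :> R.
Proof. by rewrite lossE ler_pdivrMr ?ltr0n // mul1r ler_nat orbit_dist_len. Qed.

Lemma loss_ge0 s t : 0 <= loss s t :> R.
Proof. by rewrite lossE divr_ge0. Qed.

(** If the excess is above g x n, the second term exceeds 1, hence the risk. Otherwise labelings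
    within x n cost at most x, and each farther one is handled by the raw score or by the
    temperature, according to whether its raw score deficit stays within 2 g m. *)
Lemma gibbs_risk_le (l g x : R) (s0 : labeling n K) : 0 <= l -> 0 < g -> 0 < x -> s0 \in Sigma n K ->
  \sum_t gibbs lam eps D A t * loss s0 t <=
  x + degree_excess A D s0 / (g * (x * n%:R)) +
  KF^-1 * \sum_(t in Sigma n K | x * n%:R < (orbit_dist s0 t)%:R)
    (expR (l * (raw_score A (cluster_mx R t) - raw_score A (cluster_mx R s0))
           + 2 * l * g * (orbit_dist s0 t)%:R)
     + expR (- (eta * g * (orbit_dist s0 t)%:R))).
Proof.
move=> l0 g0 x0 sS; have n0 : 0 < n%:R :> R by rewrite ltr0n.
have P0 := perm_count_gt0; have et0 : 0 < eta by rewrite divr_gt0 // mulr_gt0.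
set De := degree_excess _ _ _; have De0 : 0 <= De := degree_excess_ge0 _ _ _.
have gx0 : 0 < g * (x * n%:R) by rewrite !mulr_gt0.
have [Dbig|Dsmall] := ltrP (g * (x * n%:R)) De.
  apply: le_trans (_ : 1 <= _).
    apply: le_trans (sum_gibbs_le1 sS); apply: ler_sum => t _.
    by rewrite ler_piMr ?gibbs_ge0 ?loss_le1.
  have : 1 <= De / (g * (x * n%:R)) by rewrite ler_pdivlMr // mul1r ltW.
  set Z := KF^-1 * _; have : 0 <= Z; last by lra.
  apply: mulr_ge0; first by rewrite invr_ge0 ltW.
  by apply: sumr_ge0 => t _; rewrite addr_ge0 ?expR_ge0.
set U := \sum_(t in _ | _) _.
pose V := \sum_(t in Sigma n K | x * n%:R < (orbit_dist s0 t)%:R) gibbs lam eps D A t.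
apply: le_trans (_ : x + V <= _).
  apply: le_trans (_ : (\sum_(t : labeling n K) gibbs lam eps D A t * x) + V <= _); last first.
    by rewrite lerD2r -mulr_suml ler_piMl ?(ltW x0) // (sum_gibbs_le1 sS).
  rewrite /V [X in _ <= _ + X]big_mkcond -big_split; apply: ler_sum => t _ /=.
  have G0 := gibbs_ge0 lam eps D A t.
  case: ifP => [_|/negbT].
    apply: le_trans (_ : gibbs lam eps D A t <= _).
      by rewrite ler_piMr ?loss_le1.
    by rewrite lerDr mulr_ge0 // ltW.
  rewrite negb_and addr0 => /orP[/negPf tS|]; first by rewrite /gibbs tS !mul0r.
  by rewrite -leNgt => mx; rewrite ler_wpM2l // lossE ler_pdivrMr.
apply: lerD; first by rewrite lerDl divr_ge0 // ltW.
rewrite /V /U mulr_sumr; apply: ler_sum => t /andP[tS mx].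
set m := (orbit_dist s0 t)%:R in mx *; set dl := raw_score _ _ - _.
have m0 : 0 < m by apply: lt_trans mx; rewrite mulr_gt0.
have [pos|neg] := lerP 0 (dl + 2 * g * m).
  (* Comparing [t] with its own orbit gives the trivial bound 1/K!, and the exponential is at least
     1 here. *)
  apply: le_trans (gibbs_le t tS) _; rewrite subrr mulr0 expR0 mulr1.
  rewrite -[leLHS]mulr1 ler_wpM2l ?invr_ge0 ?(ltW P0) //.
  rewrite -[leLHS]addr0 lerD ?expR_ge0 // -[leLHS]expR0 ler_expR.
  have -> : l * dl + 2 * l * g * m = l * (dl + 2 * g * m) by ring.
  exact: mulr_ge0.
(* The deficit exceeds 2 g m and the excess is at most g x n <= g m, so a gap of g m remains. *)
apply: le_trans (gibbs_le t sS) _; rewrite ler_wpM2l ?invr_ge0 ?(ltW P0) //.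
rewrite -[leLHS]add0r lerD ?expR_ge0 // ler_expR -mulrA -mulrN ler_wpM2l ?(ltW et0) //.
have := Tscore_diff_le lam A (ltW D_gt0) sS tS; rewrite -/De -/dl.
have : g * (x * n%:R) <= g * m by rewrite ler_wpM2l // ltW.
lra.
Qed.

End Risk.
End GibbsRisk.

(** * Moment generating functions under the block model *)

Section SBM.
Variables (R : realType) (n K : nat).
Implicit Types (A : graph n) (s t : labeling n K).

Definition edge_code A : {ffun 'I_n * 'I_n -> bool} :=
  [ffun p : 'I_n * 'I_n => (p.1 < p.2)%N && adj A p.1 p.2].

Lemma edge_code_inj : injective edge_code.
Proof.
move=> A B /ffunP AB; apply: val_inj; apply/matrixP => i j.
have H (k l : 'I_n) : (k < l)%N -> adj A k l = adj B k l.
  by move=> kl; have := AB (k, l); rewrite !ffunE /= kl.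
rewrite -/(adj A i j) -/(adj B i j).
have [ij|ji|/val_inj ->] := ltngtP i j; first exact: H.
  by rewrite adj_sym H // adj_sym.
by rewrite !adj_irr.
Qed.

(** Expanding the product sums over all Boolean functions on pairs. [edge_code] embeds the graphs
    among them and the other terms are nonnegative, so its injectivity is enough for an
    inequality. *)
Lemma sum_graph_prod_le (G : 'I_n -> 'I_n -> bool -> R) :
    (forall i j c, 0 <= G i j c) ->
  \sum_A \prod_(i : 'I_n) \prod_(j : 'I_n | (i < j)%N) G i j (adj A i j) <=
  \prod_(i : 'I_n) \prod_(j : 'I_n | (i < j)%N) (G i j true + G i j false).
Proof.
move=> G0.
pose F (p : 'I_n * 'I_n) c := if (p.1 < p.2)%N then G p.1 p.2 c else (~~ c)%:R.
have F0 p c : 0 <= F p c by rewrite /F; case: ifP; rewrite ?ler0n.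
have -> : \prod_(i : 'I_n) \prod_(j : 'I_n | (i < j)%N) (G i j true + G i j false)
    = \prod_p \sum_c F p c.
  rewrite pair_big_dep big_mkcond /=; apply: eq_bigr => -[i j] _ /=.
  by rewrite big_bool /F /=; case: ifP => //; rewrite add0r.
rewrite bigA_distr_bigA /=.
rewrite (eq_bigr (fun A => \prod_p F p (edge_code A p))) => [|A _].
  rewrite -(eq_bigl _ _ (fun A => finset.in_setT A)).
  rewrite -(big_imset (fun f : {ffun 'I_n * 'I_n -> bool} => \prod_p F p (f p))
    (h := edge_code)) => [|A B _ _]; last exact: edge_code_inj.
  rewrite big_mkcond; apply: ler_sum => f _; case: ifP => // _.
  exact: prodr_ge0.
rewrite pair_big_dep big_mkcond /=; apply: eq_bigr => -[i j] _ /=.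
by rewrite /F ffunE /=; case: ifP.
Qed.

Variables (a b : R) (s0 : labeling n K).
Hypotheses (n_gt0 : (0 < n)%N) (a_bounds : 0 <= a <= n%:R) (b_bounds : 0 <= b <= n%:R).

Lemma edge_prob_bounds i j : 0 <= edge_prob a b s0 i j <= 1.
Proof.
have n0 : 0 < n%:R :> R by rewrite ltr0n.
have /andP[a0 an] := a_bounds; have /andP[b0 bn] := b_bounds.
by rewrite /edge_prob ler_pdivrMr // mul1r; case: ifP => _; rewrite divr_ge0.
Qed.

Lemma sbm_ge0 A : 0 <= sbm a b s0 A.
Proof.
apply: prodr_ge0 => i _; apply: prodr_ge0 => j _.
by have := edge_prob_bounds i j; case: ifP => _ /andP[]; rewrite ?subr_ge0.
Qed.

Lemma sbm_mgf (c : 'I_n -> 'I_n -> R) :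
  \sum_A sbm a b s0 A *
    expR (\sum_(i : 'I_n) \sum_(j : 'I_n | (i < j)%N) (adj A i j)%:R * c i j) <=
  expR (\sum_(i : 'I_n) \sum_(j : 'I_n | (i < j)%N)
          edge_prob a b s0 i j * (expR (c i j) - 1)).
Proof.
pose G i j d : R := (if d then edge_prob a b s0 i j else 1 - edge_prob a b s0 i j)
  * expR (d%:R * c i j).
have G0 i j d : 0 <= G i j d.
  rewrite mulr_ge0 ?expR_ge0 //; have := edge_prob_bounds i j.
  by case: d => /andP[]; rewrite ?subr_ge0.
have -> : \sum_A sbm a b s0 A *
    expR (\sum_(i : 'I_n) \sum_(j : 'I_n | (i < j)%N) (adj A i j)%:R * c i j) =
    \sum_A \prod_(i : 'I_n) \prod_(j : 'I_n | (i < j)%N) G i j (adj A i j).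
  apply: eq_bigr => A _; rewrite expR_sum -big_split; apply: eq_bigr => i _ /=.
  by rewrite expR_sum -big_split; apply: eq_bigr => j _ /=; rewrite /G.
apply: le_trans (sum_graph_prod_le G0) _.
rewrite expR_sum; apply: ler_prod => i _; apply/andP; split.
  by apply: prodr_ge0 => j _; rewrite addr_ge0.
rewrite expR_sum; apply: ler_prod => j _; apply/andP; split.
  by rewrite addr_ge0.
apply: le_trans (expR_ge1Dx _); rewrite /G mul1r mul0r expR0.
rewrite le_eqVlt; apply/orP; left; apply/eqP; ring.
Qed.

Lemma sum_sbm_le1 : \sum_A sbm a b s0 A <= 1.
Proof.
have := sbm_mgf (fun _ _ => 0).
rewrite expR0 subrr.
have -> : \sum_(i : 'I_n) \sum_(j : 'I_n | (i < j)%N) edge_prob a b s0 i j * 0 = 0.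
  by apply: big1 => i _; apply: big1 => j _; rewrite mulr0.
rewrite expR0; apply: le_trans; apply: ler_sum => A _.
rewrite [X in expR X]big1 ?expR0 ?mulr1 // => i _.
by apply: big1 => j _; rewrite mulr0.
Qed.

Hypotheses (Kn : (K %| n)%N) (K_gt0 : (0 < K)%N) (s0S : s0 \in Sigma n K).

Lemma cluster_sizeE : (n %/ K)%:R = n%:R / K%:R :> R.
Proof.
rewrite -[X in X%:R / _](divnK Kn) natrM mulfK // pnatr_eq0 -lt0n //.
Qed.

Lemma degree_excess_mean D : b <= a ->
  \sum_A sbm a b s0 A * degree_excess A D s0 <=
  n%:R * expR (a / K%:R * (expR 1 - 1) - D).
Proof.
move=> ba; have n0 : 0 < n%:R :> R by rewrite ltr0n.
have /andP[a0 an] := a_bounds; have /andP[b0 bn] := b_bounds.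
have -> : \sum_A sbm a b s0 A * degree_excess A D s0 =
    \sum_i \sum_A sbm a b s0 A * expR (cluster_degree R A s0 i - D).
  by rewrite exchange_big /=; apply: eq_bigr => A _; rewrite mulr_sumr.
suff H i : \sum_A sbm a b s0 A * expR (cluster_degree R A s0 i - D) <=
    expR (a / K%:R * (expR 1 - 1) - D).
  by apply: le_trans (ler_sum _ (fun i _ => H i)) _; rewrite sumr_const card_ord mulr_natl.
under eq_bigr do rewrite expRD mulrA.
rewrite -mulr_suml expRD ler_wpM2r ?expR_ge0 //.
(* This writes the degree of [i] as a linear form in the independent upper-triangular entries; its
   coefficients are 0 or 1, whence e^c - 1 = (e - 1) c. *)
pose c (k l : 'I_n) : R := ((k == i)%:R + (l == i)%:R) * cluster_mx R s0 k l.
have cdE A : cluster_degree R A s0 i =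
    \sum_(k : 'I_n) \sum_(l : 'I_n | (k < l)%N) (adj A k l)%:R * c k l.
  have := cluster_degree_sum A s0 (fun k => (k == i)%:R : R).
  rewrite (bigD1 i) //= eqxx mul1r big1 ?addr0 => [->|k /negPf->]; last by rewrite mul0r.
  by apply: eq_bigr => k _; apply: eq_bigr => l _; rewrite /c; ring.
under eq_bigr do rewrite cdE.
apply: le_trans (sbm_mgf c) _; rewrite ler_expR.
have e1 := expR_ge1Dx (1 : R).
apply: le_trans (_ : \sum_(k : 'I_n) \sum_(l : 'I_n | (k < l)%N)
    a / n%:R * (expR 1 - 1) * c k l <= _).
  apply: ler_sum => k _; apply: ler_sum => l kl.
  have p_le : edge_prob a b s0 k l <= a / n%:R.
    by rewrite /edge_prob ler_pM2r ?invr_gt0 //; case: ifP.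
  have /andP[p0 _] := edge_prob_bounds k l.
  have -> : expR (c k l) - 1 = (expR 1 - 1) * c k l.
    rewrite /c mxE; case: (k =P i) kl => [->|_]; case: (l =P i) => [->|_] kl.
    - by rewrite ltnn in kl.
    - by case: eqP => _ /=; rewrite ?(addr0, mulr1, mulr0, expR0, subrr).
    - by case: eqP => _ /=; rewrite ?(add0r, mulr1, mulr0, expR0, subrr).
    - by rewrite addr0 mul0r expR0 subrr mulr0.
  rewrite mulrA ler_wpM2r //; last by rewrite ler_wpM2r //; lra.
  by rewrite /c mulr_ge0 ?cluster_mx_ge0.
have cS : \sum_(k : 'I_n) \sum_(l : 'I_n | (k < l)%N) c k l <= (n %/ K)%:R.
  rewrite -(cluster_mx_rowsum R i s0S).
  have := sum_upper (fun k l => (k == i)%:R * cluster_mx R s0 k l).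
  rewrite (bigD1 i) //= [X in _ + X]big1 => [|k /negPf ki]; last first.
    by apply: big1 => l _; rewrite ki mul0r.
  under eq_bigr do rewrite eqxx mul1r.
  rewrite addr0 => ->; rewrite -[leLHS]add0r lerD //.
    by apply: sumr_ge0 => k _; rewrite mulr_ge0 ?cluster_mx_ge0.
  apply: ler_sum => k _; apply: ler_sum => l _.
  by rewrite /c [cluster_mx _ _ l k]cluster_mx_sym mulrDl.
under eq_bigr do rewrite -mulr_sumr.
rewrite -mulr_sumr; apply: le_trans (ler_wpM2l _ cS) _.
  by rewrite mulr_ge0 ?divr_ge0 //; lra.
rewrite cluster_sizeE le_eqVlt; apply/orP; left; apply/eqP.
by field; rewrite !gt_eqF // ltr0n.
Qed.

(* With e^l = rho^(-1/2), the exponent b(e^l - 1) + a(e^-l - 1) is at most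
   -a(1 - sqrt rho)^2. *)
Lemma raw_score_mgf (rho : R) t : 0 < rho < 1 -> b <= rho * a -> t \in Sigma n K ->
  \sum_A sbm a b s0 A * expR (- ln rho / 2 *
      (raw_score A (cluster_mx R t) - raw_score A (cluster_mx R s0))) <=
  expR (- ((1 - Num.sqrt rho) ^+ 2 / 2 * (a / K%:R) * (orbit_dist s0 t)%:R)).
Proof.
move=> /andP[r0 r1] bra tS; set l := - ln rho / 2.
have n0 : 0 < n%:R :> R by rewrite ltr0n.
have /andP[a0 an] := a_bounds; have /andP[b0 bn] := b_bounds.
pose c (i j : 'I_n) : R := l * (cluster_mx R t i j - cluster_mx R s0 i j).
under eq_bigr => A _.
  rewrite !raw_scoreE (_ : l * _ = \sum_(i : 'I_n) \sum_(j : 'I_n | (i < j)%N)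
      (adj A i j)%:R * c i j); last first.
    rewrite -sumrB mulr_sumr; apply: eq_bigr => i _.
    by rewrite -sumrB mulr_sumr; apply: eq_bigr => j _; rewrite /c; ring.
  over.
apply: le_trans (sbm_mgf c) _; rewrite ler_expR.
set sr := Num.sqrt rho.
have sr2 : sr ^+ 2 = rho by rewrite sqr_sqrtr // ltW.
have sr0 : 0 < sr by rewrite sqrtr_gt0.
have lE : l = - ln sr.
  by rewrite /l -sr2 expr2 lnM ?posrE //; field.
have elN : expR (- l) = sr by rewrite lE opprK lnK ?posrE.
have el : expR l = sr^-1 by rewrite lE expRN lnK ?posrE.
pose Y (i j : 'I_n) : R := cluster_mx R s0 i j * cluster_mx R t i j.
have YS : \sum_i Y i i = n%:R.
  by rewrite (eq_bigr (fun=> 1)) ?sumr_const ?card_ord // => i _; rewrite /Y !cluster_mxxx mulr1.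
have Yup : \sum_(i : 'I_n) \sum_(j : 'I_n | (i < j)%N) Y i j =
    ((common_pairs s0 t)%:R - n%:R) / 2.
  rewrite upper_sum_sym => [|i j]; last by rewrite /Y !(cluster_mx_sym _ _ i j).
  by rewrite common_pairsE YS.
(* Pairs joined only by [t] have probability b/n and tilt [l]; pairs joined only by [s0] have a/n
   and [- l]. Balance makes both kinds equally numerous, so one count [N] factors out. *)
have pE i j : edge_prob a b s0 i j * (expR (c i j) - 1) =
    b / n%:R * (sr^-1 - 1) * (cluster_mx R t i j - Y i j) +
    a / n%:R * (sr - 1) * (cluster_mx R s0 i j - Y i j).
  rewrite /edge_prob /c /Y !mxE; case: (s0 i == s0 j); case: (t i == t j);
    rewrite /= ?mulr1n ?mulr0n ?subrr ?sub0r ?subr0 ?mulr0 ?mulr1 ?mulrN1 ?expR0 ?elN ?el; ring.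
under eq_bigr do under eq_bigr do rewrite pE.
have -> : \sum_(i : 'I_n) \sum_(j : 'I_n | (i < j)%N)
    (b / n%:R * (sr^-1 - 1) * (cluster_mx R t i j - Y i j) +
     a / n%:R * (sr - 1) * (cluster_mx R s0 i j - Y i j)) =
    (b / n%:R * (sr^-1 - 1) + a / n%:R * (sr - 1)) *
    ((n%:R * (n %/ K)%:R - (common_pairs s0 t)%:R) / 2).
  under eq_bigr do rewrite big_split -!mulr_sumr !sumrB /=.
  rewrite big_split -!mulr_sumr !sumrB /= !cluster_upper_sum // Yup; ring.
set N := (_ - _) / 2.
have NS : (n %/ K)%:R * (orbit_dist s0 t)%:R / 2 <= N.
  have := common_pairs_le s0S tS; rewrite -(ler_nat R) natrM natrB ?orbit_dist_len //.
  by rewrite /N; lra.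
have k_le : b / n%:R * (sr^-1 - 1) + a / n%:R * (sr - 1) <= - (a / n%:R * (1 - sr) ^+ 2).
  have sr1 : sr <= 1 by rewrite -sqrtr1 ler_sqrt // ltW.
  have i1 : 0 <= sr^-1 - 1 by rewrite subr_ge0 invf_ge1.
  apply: le_trans (_ : rho * a / n%:R * (sr^-1 - 1) + a / n%:R * (sr - 1) <= _).
    by rewrite lerD2r ler_wpM2r // ler_pM2r ?invr_gt0.
  rewrite -sr2 le_eqVlt; apply/orP; left; apply/eqP.
  by field; rewrite !gt_eqF.
have C0 : 0 <= a / n%:R * (1 - sr) ^+ 2 by rewrite mulr_ge0 ?divr_ge0 ?sqr_ge0.
have N0 : 0 <= N by apply: le_trans NS; rewrite divr_ge0 ?mulr_ge0.
apply: le_trans (ler_wpM2r N0 k_le) _; rewrite mulNr lerN2.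
apply: le_trans (ler_wpM2l C0 NS); rewrite cluster_sizeE le_eqVlt.
by apply/orP; left; apply/eqP; field; rewrite !gt_eqF // ltr0n.
Qed.

End SBM.

(** * Exponential sums over labelings far from the truth *)

Section Tail.
Variables (R : realType) (n K : nat).
Hypotheses (n_gt0 : (0 < n)%N) (K_gt0 : (0 < K)%N).
Variable s0 : labeling n K.
Implicit Types t : labeling n K.

Lemma sum_hamming_pow (c : R) :
  \sum_t c ^+ hamming t s0 = (1 + (K%:R - 1) * c) ^+ n.
Proof.
transitivity (\sum_(t : labeling n K) \prod_i (if t i == s0 i then 1 else c)).
  apply: eq_bigr => t _; rewrite (bigID (fun i => t i == s0 i)) /= big1 ?mul1r => [|i ->//].
  rewrite (eq_bigr (fun=> c)) => [|i /negPf->//]; rewrite prodr_const.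
  by congr (_ ^+ _); apply: eq_card => i; rewrite inE.
rewrite -(bigA_distr_bigA (fun i k => if k == s0 i then 1 else c)).
rewrite (eq_bigr (fun=> 1 + (K%:R - 1) * c)) ?prodr_const ?card_ord // => i _.
rewrite (bigD1 (s0 i)) //= eqxx (eq_bigr (fun=> c)) => [|k /negPf->//].
by rewrite sumr_const cardC1 card_ord -[_ *+ _.-1]mulr_natl -subn1 natrB.
Qed.

(** A union bound over the permutation that attains the orbit distance costs K!, which the prefactor
    repays. *)
Lemma sum_orbit_le (P : nat -> bool) (f : nat -> R) : (forall m, 0 <= f m) ->
  #|{perm 'I_K}|%:R^-1 * (\sum_(t in Sigma n K | P (orbit_dist s0 t)) f (orbit_dist s0 t))
  <= \sum_(t : labeling n K | P (hamming t s0)) f (hamming t s0).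
Proof.
move=> f0; have P0 : 0 < #|{perm 'I_K}|%:R :> R.
  by rewrite ltr0n; apply/card_gt0P; exists 1%g.
rewrite mulrC ler_pdivrMr // big_mkcond /=.
apply: le_trans (_ : \sum_t \sum_(p : {perm 'I_K})
    (if P (hamming (relabel p t) s0) then f (hamming (relabel p t) s0) else 0) <= _).
  apply: ler_sum => t _.
  have ge0 p : 0 <= if P (hamming (relabel p t) s0) then f (hamming (relabel p t) s0) else 0.
    by case: ifP.
  case: ifP => [/andP[_ Pt]|_]; last by apply: sumr_ge0 => p _.
  have [p pE] := orbit_dist_attained t s0; rewrite orbit_distC pE in Pt *.
  by rewrite (bigD1 p) //= Pt lerDl; apply: sumr_ge0 => q _.
rewrite exchange_big /= mulr_natr.
rewrite (eq_bigr (fun=> \sum_(t : labeling n K | P (hamming t s0)) f (hamming t s0))).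
  by rewrite sumr_const.
move=> p _; rewrite [RHS](reindex_inj (@relabel_inj n K p)) /= [RHS]big_mkcond.
by apply: eq_bigr.
Qed.

(* Exponential tilting: on h >= y n the weight exp(-tau h) is at most
   (exp(-tau) K / y)^(y n) (y / K)^h. *)
Lemma hamming_tail (tau y : R) : n%:R^-1 <= y ->
    expR 1 * K%:R * expR (- tau) / y <= 1 ->
  \sum_(t : labeling n K | y * n%:R <= (hamming t s0)%:R) expR (- (tau * (hamming t s0)%:R))
  <= expR 1 * K%:R * expR (- tau) / y.
Proof.
move=> y_ge B1; have n0 : 0 < n%:R :> R by rewrite ltr0n.
have K0 : 0 < K%:R :> R by rewrite ltr0n.
have y0 : 0 < y by apply: lt_le_trans y_ge; rewrite invr_gt0.
have yn1 : 1 <= y * n%:R by rewrite -ler_pdivrMr // div1r.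
set B := _ / y in B1 *; have B0 : 0 < B by rewrite divr_gt0 // !mulr_gt0 ?expR_gt0.
pose c := y / K%:R; have c0 : 0 < c by rewrite divr_gt0.
have lnB : ln B = 1 - tau - ln c.
  have -> : B = expR (1 - tau - ln c).
    rewrite !expRD !expRN lnK ?posrE // /B /c expRN.
    by field; rewrite !gt_eqF ?expR_gt0.
  by rewrite expRK.
have lnB0 : ln B <= 0 by rewrite ln_le0.
have tilt0 : - tau - ln c <= 0 by move: lnB0; rewrite lnB; lra.
apply: le_trans (_ : expR (y * n%:R * (- tau - ln c)) * \sum_t c ^+ hamming t s0 <= _).
  rewrite mulr_sumr [leLHS]big_mkcond; apply: ler_sum => t _.
  case: ifP => [yh|_]; last by rewrite mulr_ge0 ?expR_ge0 ?exprn_ge0 ?ltW.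
  rewrite -[c in c ^+ _]lnK ?posrE // -expRM_natr -expRD ler_expR.
  have : (hamming t s0)%:R * (- tau - ln c) <= y * n%:R * (- tau - ln c).
    by rewrite ler_wnM2r.
  lra.
rewrite sum_hamming_pow.
apply: le_trans (_ : expR (y * n%:R * (- tau - ln c)) * expR (y * n%:R) <= _).
  rewrite ler_wpM2l ?expR_ge0 // expRM_natr lerXn2r ?nnegrE ?expR_ge0 //.
    by rewrite addr_ge0 // mulr_ge0 ?(ltW c0) // subr_ge0 ler1n.
  apply: le_trans (expR_ge1Dx _); rewrite lerD2l.
  have -> : y = K%:R * c by rewrite /c; field; rewrite gt_eqF.
  by rewrite ler_wpM2r ?(ltW c0) //; lra.
rewrite -expRD -[leRHS]lnK ?posrE // ler_expR lnB.
(* The bound reached is B^(y n), at most B because B <= 1 <= y n. *)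
have : y * n%:R * ln B <= 1 * ln B by rewrite ler_wnM2r.
by rewrite lnB; lra.
Qed.

(** A positive integer distance is at least 1, so the cut at x n may be raised to y n >= 1, as
    [hamming_tail] requires. *)
Lemma orbit_tail (tau x : R) (y := Num.max x n%:R^-1) : 0 < x ->
    expR 1 * K%:R * expR (- tau) / y <= 1 ->
  #|{perm 'I_K}|%:R^-1 *
    (\sum_(t in Sigma n K | x * n%:R < (orbit_dist s0 t)%:R)
       expR (- (tau * (orbit_dist s0 t)%:R)))
  <= expR 1 * K%:R * expR (- tau) / y.
Proof.
move=> x0 B1; have n0 : 0 < n%:R :> R by rewrite ltr0n.
apply: le_trans (sum_orbit_le (fun m => x * n%:R < m%:R)
  (f := fun m => expR (- (tau * m%:R))) _) _ => [m|]; first exact: expR_ge0.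
apply: le_trans (hamming_tail _ B1); last by rewrite /y le_max lexx orbT.
rewrite big_mkcond [leRHS]big_mkcond; apply: ler_sum => t _.
case: ifP => xh; last by case: ifP => // _; exact: expR_ge0.
rewrite /y maxr_pMl ?(ltW n0) // mulVf ?gt_eqF // ge_max (ltW xh) /= ler1n.
rewrite lt0n; suff -> : hamming t s0 != 0%N by [].
apply/eqP => h0; move: xh; rewrite h0 ltNge => /negP; apply.
by rewrite mulr_ge0 // ltW.
Qed.

End Tail.

(** * Mean risk of the Gibbs law and transfer to the algorithm *)

Section MeanRisk.
Variables (R : realType) (n K : nat) (a b lam eps D rho : R).
Hypotheses (n_gt0 : (0 < n)%N) (K_gt1 : (1 < K)%N) (Kn : (K %| n)%N).
Hypotheses (a_gt0 : 0 < a) (a_len : a <= n%:R) (b_ge0 : 0 <= b) (b_le : b <= rho * a).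
Hypotheses (rho_bounds : 0 < rho < 1) (eps_gt0 : 0 < eps) (D_gt0 : 0 < D).

Definition gap_rate (r : R) : R := (1 - Num.sqrt r) ^+ 2.

(* Margin, in units of (a / K) * orbit_dist, that separates the raw score
   difference from the temperature term. *)
Definition margin (r : R) : R := gap_rate r / (8 * (- ln r / 2)).

Lemma gap_rate_bounds : 0 < gap_rate rho <= 1.
Proof.
have /andP[r0 r1] := rho_bounds; rewrite /gap_rate; set sr := Num.sqrt rho.
have sr0 : 0 < sr by rewrite sqrtr_gt0.
have sr1 : sr < 1 by rewrite -sqrtr1 ltr_sqrt.
by apply/andP; split; [apply: exprn_gt0|apply: exprn_ile1]; lra.
Qed.

Lemma margin_gt0 : 0 < margin rho.
Proof.
have /andP[c0 _] := gap_rate_bounds; have /andP[r0 r1] := rho_bounds.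
have l0 : ln rho < 0 by rewrite ln_lt0 // r0.
by rewrite divr_gt0 //; lra.
Qed.

Lemma mean_gibbs_risk (s0 : labeling n K) (x : R) (y := Num.max x n%:R^-1)
    (B1 := expR 1 * K%:R * expR (- (gap_rate rho / 4 * (a / K%:R))) / y)
    (B2 := expR 1 * K%:R * expR (- (gibbs_eta eps D * (margin rho * (a / K%:R)))) / y) :
    s0 \in Sigma n K -> 0 < x -> B1 <= 1 -> B2 <= 1 ->
  \sum_A sbm a b s0 A * (\sum_t gibbs lam eps D A t * loss s0 t) <=
  x + n%:R * expR (a / K%:R * (expR 1 - 1) - D)
      / (margin rho * (a / K%:R) * (x * n%:R)) + B1 + B2.
Proof.
move=> s0S x0 B1le B2le.
have /andP[r0 r1] := rho_bounds; have d0 := margin_gt0.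
have K_gt0 : (0 < K)%N by rewrite ltnW.
have K0 : 0 < K%:R :> R by rewrite ltr0n.
have n0 : 0 < n%:R :> R by rewrite ltr0n.
have S0 : (0 < n %/ K)%N by rewrite divn_gt0 // (dvdn_leq n_gt0 Kn).
have ab : b <= a by apply: le_trans b_le _; rewrite ler_piMl ?ltW.
have a_b : 0 <= a <= n%:R by rewrite (ltW a_gt0).
have b_b : 0 <= b <= n%:R by rewrite b_ge0 (le_trans ab).
set g := margin rho * (a / K%:R); have g0 : 0 < g by rewrite mulr_gt0 // divr_gt0.
set l := - ln rho / 2.
have l0 : 0 < l by rewrite /l; have : ln rho < 0; [rewrite ln_lt0 // r0|lra].
(* The 8 in [margin] makes the tilt cost exactly half of the exponent of [raw_score_mgf]. *)
have lg : 2 * l * g = gap_rate rho / 4 * (a / K%:R).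
  by rewrite /g /margin -/l; field; rewrite !gt_eqF.
have P0 : 0 < #|{perm 'I_K}|%:R^-1 :> R.
  by rewrite invr_gt0 ltr0n; apply/card_gt0P; exists 1%g.
set KF := _^-1 in P0.
pose w (A : graph n) := sbm a b s0 A.
have w0 A : 0 <= w A := sbm_ge0 s0 n_gt0 a_b b_b A.
pose m (t : labeling n K) : R := (orbit_dist s0 t)%:R.
pose dl (A : graph n) (t : labeling n K) : R := raw_score A (cluster_mx R t) - raw_score A (cluster_mx R s0).
pose De (A : graph n) := degree_excess A D s0.
pose far (t : labeling n K) := (t \in Sigma n K) && (x * n%:R < m t).
have w1 : \sum_A w A <= 1 by apply: sum_sbm_le1.
pose risk (A : graph n) := x + De A / (g * (x * n%:R)) +
    KF * \sum_(t | far t) (expR (l * dl A t + 2 * l * g * m t)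
                           + expR (- (gibbs_eta eps D * g * m t))).
apply: (@le_trans _ _ (\sum_A w A * risk A)).
  apply: ler_sum => A _; apply: ler_wpM2l => //.
  exact: (gibbs_risk_le lam A S0 n_gt0 eps_gt0 D_gt0 (ltW l0) g0 x0 s0S).
have -> : \sum_A w A * risk A =
    x * (\sum_A w A) + (\sum_A w A * De A) / (g * (x * n%:R)) +
    KF * (\sum_(t | far t) expR (2 * l * g * m t) * \sum_A w A * expR (l * dl A t)) +
    (\sum_A w A) * (KF * \sum_(t | far t) expR (- (gibbs_eta eps D * g * m t))).
  transitivity (\sum_A (x * w A + w A * De A / (g * (x * n%:R)) +
    KF * (\sum_(t | far t) expR (2 * l * g * m t) * (w A * expR (l * dl A t))) +
    w A * (KF * \sum_(t | far t) expR (- (gibbs_eta eps D * g * m t))))).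
    apply: eq_bigr => A _; rewrite /risk big_split /=.
    have -> : \sum_(t | far t) expR (2 * l * g * m t) * (w A * expR (l * dl A t)) =
        w A * \sum_(t | far t) expR (l * dl A t + 2 * l * g * m t).
      by rewrite mulr_sumr; apply: eq_bigr => t _; rewrite expRD; ring.
    ring.
  rewrite !big_split /= -mulr_sumr -!mulr_suml -mulr_sumr exchange_big /=.
  by congr (_ + _ * _ + _); apply: eq_bigr => t _; rewrite mulr_sumr.
have T1 : x * \sum_A w A <= x by rewrite ler_piMr // ltW.
have T2 : (\sum_A w A * De A) / (g * (x * n%:R)) <=
    n%:R * expR (a / K%:R * (expR 1 - 1) - D) / (g * (x * n%:R)).
  have gx0 : 0 < g * (x * n%:R) by apply: mulr_gt0 => //; apply: mulr_gt0.
  rewrite ler_pM2r ?invr_gt0 //; exact: (degree_excess_mean n_gt0 a_b b_b Kn K_gt0 s0S D ab).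
have T3 : KF * (\sum_(t | far t) expR (2 * l * g * m t) * \sum_A w A * expR (l * dl A t))
    <= B1.
  apply: le_trans (orbit_tail n_gt0 K_gt0 s0 x0 B1le); rewrite ler_wpM2l ?(ltW P0) //.
  apply: ler_sum => t /andP[tS _].
  apply: le_trans (ler_wpM2l (expR_ge0 _)
    (raw_score_mgf n_gt0 a_b b_b Kn K_gt0 s0S rho_bounds b_le tS)) _.
  rewrite -expRD ler_expR lg -/(m t) -/(gap_rate rho) le_eqVlt; apply/orP; left.
  by apply/eqP; field; rewrite gt_eqF.
have T4 : (\sum_A w A) * (KF * \sum_(t | far t) expR (- (gibbs_eta eps D * g * m t)))
    <= B2.
  apply: le_trans (orbit_tail n_gt0 K_gt0 s0 x0 B2le); rewrite ler_piMl //.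
  by rewrite mulr_ge0 ?(ltW P0) //; apply: sumr_ge0 => t _; exact: expR_ge0.
by move: T1 T2 T3 T4; lra.
Qed.

Lemma expected_loss_le (M : nat) (theta : R) (sstar : graph n -> labeling n K)
    (s0 : labeling n K) (B : R) :
    0 <= theta -> ln (4 * n%:R * (K%:R - 1)) <= kappa K eps D theta ->
    (forall A, sstar A \in Sigma n K) ->
    \sum_A sbm a b s0 A * (\sum_t gibbs lam eps D A t * loss s0 t) <= B ->
  expected_loss a b lam eps D theta M sstar s0 <= expR (xi R M) * B.
Proof.
move=> th0 kap sS HB; have n0 : 0 < n%:R :> R by rewrite ltr0n.
have /andP[r0 r1] := rho_bounds.
have ab : b <= a by apply: le_trans b_le _; rewrite ler_piMl ?ltW.
have a_b : 0 <= a <= n%:R by rewrite (ltW a_gt0).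
have b_b : 0 <= b <= n%:R by rewrite b_ge0 (le_trans ab).
apply: le_trans (ler_wpM2l (expR_ge0 _) HB); rewrite mulr_sumr /expected_loss.
apply: ler_sum => A _; rewrite mulrCA ler_wpM2l ?sbm_ge0 //.
rewrite mulr_sumr; apply: ler_sum => t _; rewrite [leRHS]mulrA ler_wpM2r ?loss_ge0 //.
exact: trunc_law_le.
Qed.

End MeanRisk.

(** * Numerical estimates behind the three rates *)

Section Rates.
Variable R : realType.
Implicit Types n K q P c d D y u A C delta : R.

Lemma ln2_ge : 1 / 2 <= ln 2 :> R.
Proof.
have H : -1 < - (1 / 2) :> R by lra.
have := le_ln1Dx H; have -> : 1 + - (1 / 2) = 2^-1 :> R by field.
by rewrite lnV ?posrE //; lra.
Qed.

(** The exponent c/4 is three times c/12, so the exponential is at most P^(-3). One power of P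
    absorbs 9 e K, and another the division by y. *)
Lemma raw_tail_rate K q P c y A0 (lnN : R) :
    0 < K -> 0 < A0 -> 0 < lnN -> 0 < c -> A0 * lnN <= q ->
    P = expR (c / 12 * A0 * lnN) -> 9 * expR 1 * K <= P -> (3 * P)^-1 <= y ->
  expR 1 * K * expR (- (c / 4 * q)) / y <= (3 * P)^-1.
Proof.
move=> K0 A00 l0 c0 qA PE KP xy; have P0 : 0 < P by rewrite PE expR_gt0.
have y0 : 0 < y by apply: lt_le_trans xy; rewrite invr_gt0 mulr_gt0.
have e0 : expR (- (c / 4 * q)) <= P ^- 3.
  rewrite PE -expRM_natr -expRN ler_expR lerN2.
  have : c / 4 * (A0 * lnN) <= c / 4 * q by rewrite ler_wpM2l //; lra.
  lra.
rewrite ler_pdivrMr // mulrC; apply: le_trans (_ : P ^- 3 * (expR 1 * K) <= _).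
  by rewrite ler_wpM2r // mulr_ge0 ?expR_ge0 // ltW.
apply: le_trans (_ : (3 * P)^-1 * (3 * P)^-1 <= _); last first.
  by rewrite ler_wpM2l // invr_ge0 mulr_ge0 // ltW.
have -> : (3 * P)^-1 * (3 * P)^-1 = P ^- 3 * (P / 9) by field; rewrite gt_eqF.
by rewrite ler_wpM2l ?invr_ge0 ?exprn_ge0 ?(ltW P0) //; lra.
Qed.

(** A cap of at least e q leaves the exponent -q, again worth P^(-3); one power pays for 1/x = 3P,
    another for the margin constant. *)
Lemma excess_rate n q P c d D A0 (lnN : R) :
    0 < n -> 0 < A0 -> 1 <= lnN -> 0 < c <= 1 -> 0 < d -> A0 * lnN <= q ->
    P = expR (c / 12 * A0 * lnN) -> 9 / (d * A0) <= P -> expR 1 * q <= D ->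
  n * expR (q * (expR 1 - 1) - D) / (d * q * ((3 * P)^-1 * n)) <= (3 * P)^-1.
Proof.
move=> n0 A00 l1 /andP[c0 c1] d0 qA PE dP Dq; have P0 : 0 < P by rewrite PE expR_gt0.
have q_A0 : A0 <= q by apply: le_trans qA; rewrite ler_peMr // ltW.
have q0 : 0 < q by apply: lt_le_trans q_A0.
have e0 : expR (q * (expR 1 - 1) - D) <= P ^- 3.
  rewrite PE -expRM_natr -expRN ler_expR.
  have : c * (A0 * lnN) <= 1 * (A0 * lnN) by rewrite ler_wpM2r // mulr_ge0 //; lra.
  have : 0 <= A0 * lnN by rewrite mulr_ge0 //; lra.
  lra.
set E := expR _ in e0 *.
have -> : n * E / (d * q * ((3 * P)^-1 * n)) = E * (3 * P / (d * q)).
  by field; rewrite !gt_eqF.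
apply: le_trans (_ : P ^- 3 * (3 * P / (d * A0)) <= _).
  have dq : (d * q)^-1 <= (d * A0)^-1.
    by rewrite lef_pV2 ?posrE ?mulr_gt0 // ler_pM2l.
  apply: ler_pM => //; first exact: expR_ge0.
    by rewrite divr_ge0 // mulr_ge0 // ltW.
  by rewrite ler_wpM2l // mulr_ge0 // ltW.
have -> : P ^- 3 * (3 * P / (d * A0)) = P ^- 2 * (1 / 3) * (9 / (d * A0)).
  by field; rewrite !gt_eqF.
have -> : (3 * P)^-1 = P ^- 2 * (1 / 3) * P by field; rewrite gt_eqF.
by rewrite ler_wpM2l // mulr_ge0 ?invr_ge0 ?exprn_ge0 ?(ltW P0) //; lra.
Qed.

(** Half of the exponent is kept; the other half is at most (nK)^(-3), and e <= nK with 1/y <= n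
    leaves 1/(nK). *)
Lemma thermal_tail_rate n K y u :
    0 < n -> 1 <= K -> 1 <= ln (n * K) -> n^-1 <= y -> 3 * ln (n * K) <= u ->
  expR 1 * K * expR (- (2 * u)) / y <= (n * K)^-1 * expR (- u).
Proof.
move=> n0 K1 l1 ny lu; have K0 : 0 < K by lra.
have N0 : 0 < n * K by rewrite mulr_gt0.
have y0 : 0 < y by apply: lt_le_trans ny; rewrite invr_gt0.
rewrite ler_pdivrMr //; apply: le_trans (_ : (n * K)^-1 * expR (- u) * n^-1 <= _); last first.
  by rewrite ler_wpM2l // mulr_ge0 ?expR_ge0 // invr_ge0 ltW.
have -> : expR (- (2 * u)) = expR (- u) * expR (- u).
  by rewrite -expRD; congr expR; ring.
have -> : expR 1 * K * (expR (- u) * expR (- u)) =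
    expR (- u) * (expR 1 * K * expR (- u)) by ring.
rewrite [leRHS](_ : _ = expR (- u) * ((n * K)^-1 * n^-1)); last by ring.
rewrite ler_wpM2l ?expR_ge0 //.
have u3 : expR (- u) <= (n * K) ^- 3.
  rewrite -{1}(lnK (_ : n * K \in Num.pos)) ?posrE // -expRM_natr -expRN ler_expR; lra.
have eN : expR 1 <= n * K by rewrite -{1}(lnK (_ : n * K \in Num.pos)) ?posrE // ler_expR.
apply: le_trans (_ : n * K * K * (n * K) ^- 3 <= _).
  apply: ler_pM; rewrite ?mulr_ge0 ?expR_ge0 ?(ltW K0) //.
  by rewrite ler_wpM2r // ltW.
rewrite le_eqVlt; apply/orP; left; apply/eqP; field.
by rewrite !gt_eqF.
Qed.

(** As ln K >= 1/2, the hypothesis gives K <= 2 C ln n, which is beaten by e^z >= z^2 / 2 at z =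
    delta ln n. *)
Lemma clusters_rate n K C delta :
    1 <= n -> 2 <= K -> 0 < C -> 0 < delta -> K * ln K <= C * ln n ->
    1 + 36 * expR 1 * C / delta ^+ 2 <= ln n ->
  9 * expR 1 * K <= expR (delta * ln (n * K)).
Proof.
move=> n1 K2 C0 d0 KC T; have l2 := ln2_ge.
have n0 : 0 < n by lra.
have lnK2 : 1 / 2 <= ln K.
  by apply: le_trans l2 _; rewrite ler_ln ?posrE //; lra.
have Kl : K <= 2 * C * ln n.
  have : K * (1 / 2) <= K * ln K by rewrite ler_wpM2l //; lra.
  lra.
have e0 : 0 < expR 1 :> R := expR_gt0 _.
set Q := 36 * expR 1 * C / delta ^+ 2 in T.
have Q0 : 0 < Q by rewrite divr_gt0 ?exprn_gt0 // !mulr_gt0.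
have ln0 : 0 < ln n by lra.
apply: le_trans (_ : (delta * ln n) ^+ 2 / 2 <= _).
  apply: le_trans (_ : 9 * expR 1 * (2 * C * ln n) <= _).
    by rewrite ler_wpM2l // mulr_ge0 // ltW.
  have -> : 9 * expR 1 * (2 * C * ln n) = delta ^+ 2 * ln n / 2 * Q.
    by rewrite /Q; field; rewrite gt_eqF.
  have -> : (delta * ln n) ^+ 2 / 2 = delta ^+ 2 * ln n / 2 * ln n by ring.
  rewrite ler_wpM2l ?divr_ge0 ?mulr_ge0 ?exprn_ge0 ?(ltW d0) ?(ltW ln0) //; lra.
apply: le_trans (_ : expR (delta * ln n) <= _).
  have := @expR_ge1Dxn _ (delta * ln n) 1 (mulr_ge0 (ltW d0) (ltW ln0)).
  by rewrite (_ : 2`!%:R = 2) //; lra.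
rewrite ler_expR ler_wpM2l ?(ltW d0) // lnM ?posrE //; lra.
Qed.

Lemma kappa_rate n K :
    1 <= n -> 2 <= K -> 4 <= n * K ->
  ln (4 * n * (K - 1)) <= 2 * ln (n * K).
Proof.
move=> n1 K2 N4; have N0 : 0 < n * K by lra.
have -> : 2 * ln (n * K) = ln ((n * K) ^+ 2) by rewrite lnXn // mulr_natl.
have nK : 0 < n * (K - 1) by rewrite mulr_gt0; lra.
rewrite ler_ln ?posrE ?exprn_gt0 //; last by lra.
rewrite expr2; have : 4 * (n * K) <= (n * K) * (n * K) by rewrite ler_pM2r.
lra.
Qed.
End Rates.

(** * Choice of constants and conclusion *)

Import numFieldNormedType.Exports.
Local Open Scope classical_set_scope.

Theorem theorem3 (R : realType) (rho_hi : R) (rho_hi_bounds : 0 < rho_hi < 1) :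
  exists Cdeg0 chi0 : R,
    0 < Cdeg0 /\ 0 < chi0 /\
  forall Cdeg chi : R, Cdeg0 <= Cdeg -> 0 < chi <= chi0 ->
  forall rho_lo : R, 0 < rho_lo <= rho_hi ->
  exists L c1 c2 c3 : R,
    0 < L /\ 0 < c1 /\ 0 < c2 /\ 0 < c3 /\
  forall (Cmg A0 : R), 0 < Cmg -> 0 < A0 ->
  forall (K : nat -> nat) (a b : nat -> R),
    (forall n, (2 <= K n)%N) ->
    assumption_clusters Cmg K ->
    assumption_degrees A0 rho_lo rho_hi K a b ->
  \forall n \near \oo, valid_size K n ->
  forall (lam eps : R) (M : nat)
         (Xhat : graph n -> 'M[R]_n) (sstar : graph n -> labeling n (K n)),
    (1 <= M)%N ->
    L * ln (n * K n)%:R <= eps ->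
    (forall A, sdp_optimal (K n) A (Xhat A)) ->
    (forall A, rounding (Xhat A) (sstar A)) ->
  let D := Cdeg * (a n / (K n)%:R) in
  let theta := chi * a n in
  ln (4 * n%:R * ((K n)%:R - 1)) <= kappa (K n) eps D theta /\
  sup [set expected_loss (a n) (b n) lam eps D theta M sstar s0
      | s0 in [set` Sigma n (K n)]]
  <= expR (xi R M) *
     (expR (- c1 * (n%:R * renyi_half n (a n) (b n) / (K n)%:R))
      + (n * K n)%:R^-1 * expR (- c2 * eps)
      + (n * K n)%:R `^ (- (c3 * A0))).
Proof.
have /andP[rh0 rh1] := rho_hi_bounds.
have /andP[c0_gt0 c0_le1] := gap_rate_bounds rho_hi_bounds.
have d_gt0 := margin_gt0 rho_hi_bounds.
set c0 := gap_rate rho_hi in c0_gt0 c0_le1; set d := margin rho_hi in d_gt0.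
have e_gt0 : 0 < expR 1 :> R := expR_gt0 _.
exists (expR 1), 1; split => //; split => // Cdeg chi Cdeg_ge /andP[chi0 _] rho_lo.
move=> /andP[rl0 _].
have Cdeg0 : 0 < Cdeg by exact: lt_le_trans Cdeg_ge.
have L1 : 0 < 2 * Cdeg / chi by rewrite divr_gt0 // mulr_gt0.
have L2 : 0 < 12 * Cdeg / d by rewrite divr_gt0 // mulr_gt0.
(* The first summand of L gives kappa >= 2 ln(nK), the second u >= 3 ln(nK) for u = c2 eps. Here c2
   eps is half of eta times the margin rate, and c3 is a third of the Chernoff exponent [c0 / 4]. *)
exists (2 * Cdeg / chi + 12 * Cdeg / d), 1, (d / (4 * Cdeg)), (c0 / 12).
split; first by rewrite addr_gt0.
split => //; split; first by rewrite divr_gt0 // mulr_gt0.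
split; first by rewrite divr_gt0.
move=> Cmg A0 Cmg0 A00 K a b K2 Kass [qA ao _ bass].
set delta := c0 / 12 * A0.
have delta0 : 0 < delta by rewrite mulr_gt0 // divr_gt0.
set Q1 := 36 * expR 1 * Cmg / delta ^+ 2.
set Q2 := 9 / (d * A0).
have Q1_gt0 : 0 < Q1 by rewrite divr_gt0 ?exprn_gt0 // !mulr_gt0.
have Q2_gt0 : 0 < Q2 by rewrite divr_gt0 // mulr_gt0.
have a_near : \forall n \near \oo, `|a n| <= 1 * `|n%:R : R|.
  by move: ao => /eqoP/(_ 1 ltr01).
(* In ln n >= 1 + Q1 + Q2/delta, the 1 gives ln(nK) >= 1, Q1 feeds [clusters_rate], and Q2/delta
   gives P >= Q2. *)
apply: filterS2 a_near (nbhs_infty_ger (expR (1 + Q1 + Q2 / delta))) => n an nT.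
move=> /andP[n_gt0 Kn] lam eps M Xhat sstar _ epsL _ rnd.
set D := Cdeg * _; set theta := chi * _; cbv zeta.
have n0 : 0 < n%:R :> R by rewrite ltr0n.
have n1 : 1 <= n%:R :> R by rewrite ler1n.
have K2R : 2 <= (K n)%:R :> R by rewrite ler_nat.
have K0 : 0 < (K n)%:R :> R by lra.
have lnn : 1 + Q1 + Q2 / delta <= ln n%:R.
  by rewrite -(expRK (1 + Q1 + Q2 / delta)) ler_ln ?posrE ?expR_gt0.
have Qd0 : 0 < Q2 / delta by rewrite divr_gt0.
have NE : (n * K n)%:R = n%:R * (K n)%:R :> R by rewrite natrM.
have N0 : 0 < n%:R * (K n)%:R :> R by rewrite mulr_gt0.
have lnN : ln n%:R <= ln (n%:R * (K n)%:R) :> R.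
  by rewrite ler_ln ?posrE // ler_peMr ?(ltW n0) //; lra.
have l1 : 1 <= ln (n%:R * (K n)%:R) :> R by lra.
have vn : valid_size K n by rewrite /valid_size n_gt0.
have qge := qA n vn; set q := a n / (K n)%:R in qge *.
rewrite NE in epsL qge *.
set lN := ln (_ * _) in epsL qge lnN l1.
have q0 : 0 < q by apply: lt_le_trans qge; rewrite mulr_gt0 //; lra.
have aE : a n = q * (K n)%:R by rewrite /q divfK // gt_eqF.
have a0 : 0 < a n by rewrite aE mulr_gt0.
have a_le : a n <= n%:R by move: an; rewrite mul1r (ger0_norm (ltW a0)) (ger0_norm (ltW n0)).
have /andP[bl bu] := bass n vn.
have b0 : 0 <= b n.
  have : 0 <= b n / a n by exact: le_trans (ltW rl0) bl.
  by rewrite pmulr_lge0 // invr_gt0.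
have b_le : b n <= rho_hi * a n by rewrite -ler_pdivrMr.
have D0 : 0 < D by rewrite mulr_gt0.
have eps1 : 2 * Cdeg / chi * lN <= eps.
  by apply: le_trans epsL; rewrite [leRHS]mulrDl lerDl mulr_ge0 //; [exact: ltW|lra].
have eps2 : 12 * Cdeg / d * lN <= eps.
  by apply: le_trans epsL; rewrite [leRHS]mulrDl lerDr mulr_ge0 //; [exact: ltW|lra].
have eps0 : 0 < eps by apply: lt_le_trans eps1; rewrite mulr_gt0 //; lra.
have n2 : (2 <= n)%N by apply: leq_trans (K2 n) _; exact: dvdn_leq.
have N4 : 4 <= n%:R * (K n)%:R :> R.
  by rewrite -natrM ler_nat; exact: (@leq_mul 2 2 n (K n)).
have kap : ln (4 * n%:R * ((K n)%:R - 1)) <= kappa (K n) eps D theta.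
  apply: le_trans (kappa_rate n1 K2R N4) _.
  have -> : kappa (K n) eps D theta = eps * (chi / Cdeg).
    by rewrite /kappa /gibbs_eta /D /theta aE; field; rewrite !gt_eqF.
  apply: le_trans (_ : 2 * Cdeg / chi * lN * (chi / Cdeg) <= _).
    rewrite -/lN le_eqVlt; apply/orP; left; apply/eqP; field.
    by rewrite !gt_eqF.
  by rewrite ler_wpM2r // divr_ge0 ?ltW.
split => //.
set P := expR (delta * lN).
have P0 : 0 < P := expR_gt0 _.
have PE : (n%:R * (K n)%:R) `^ (- (c0 / 12 * A0)) = P^-1.
  by rewrite /powR gt_eqF // -/lN -/delta mulNr expRN.
have KP : 9 * expR 1 * (K n)%:R <= P.
  by apply: (clusters_rate n1 K2R Cmg0 delta0 (Kass n vn)); rewrite -/Q1; lra.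
have dP : Q2 <= P.
  apply: le_trans (expR_ge1Dx _); apply: le_trans (_ : delta * (Q2 / delta) <= _).
    by rewrite mulrC divfK // gt_eqF.
  have : delta * (Q2 / delta) <= delta * lN by rewrite ler_wpM2l ?(ltW delta0) //; lra.
  lra.
(* Near labelings, degree excess and Chernoff tail each contribute at most x, together 1/P =
   (nK)^(-c3 A0). *)
set x := (3 * P)^-1; have x0 : 0 < x by rewrite invr_gt0 mulr_gt0.
set y := Num.max x n%:R^-1.
have xy : x <= y by rewrite le_max lexx.
have ny : n%:R^-1 <= y by rewrite le_max lexx orbT.
have B1le := raw_tail_rate K0 A00 (lt_le_trans ltr01 l1) c0_gt0 qge erefl KP xy.
have c0b : 0 < c0 <= 1 by rewrite c0_gt0.
have Exc : n%:R * expR (q * (expR 1 - 1) - D) / (d * q * (x * n%:R)) <= x.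
  apply: (excess_rate n0 A00 l1 c0b d_gt0 qge erefl dP).
  by rewrite /D ler_wpM2r // ltW.
set u := d / (4 * Cdeg) * eps.
have u3 : 3 * lN <= u.
  have -> : 3 * lN = d / (4 * Cdeg) * (12 * Cdeg / d * lN).
    by field; rewrite !gt_eqF.
  have k0 : 0 < 4 * Cdeg by rewrite mulr_gt0.
  by rewrite /u ler_wpM2l // divr_ge0 ?(ltW d_gt0) ?(ltW k0).
have K1R : 1 <= (K n)%:R :> R by lra.
have B2le := thermal_tail_rate n0 K1R l1 ny u3.
have uE : gibbs_eta eps D * (d * q) = 2 * u.
  by rewrite /gibbs_eta /u (_ : D = Cdeg * q) //; field; rewrite !gt_eqF.
rewrite -uE in B2le.
have x1 : x <= 1.
  rewrite invf_le1 ?mulr_gt0 //; have : 1 <= expR (delta * lN); last by rewrite -/P; lra.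
  apply: le_trans (expR_ge1Dx _); rewrite lerDl mulr_ge0 ?(ltW delta0) //; lra.
have N1 : (n%:R * (K n)%:R)^-1 * expR (- u) <= 1.
  rewrite -[leRHS]mulr1 ler_pM ?invr_ge0 ?expR_ge0 ?(ltW N0) //.
    by rewrite invf_le1 //; lra.
  by rewrite expR_le1; lra.
have bound s0 : s0 \in Sigma n (K n) ->
    expected_loss (a n) (b n) lam eps D theta M sstar s0 <=
    expR (xi R M) * (x + x + x + (n%:R * (K n)%:R)^-1 * expR (- u)).
  move=> s0S; apply: (expected_loss_le (rho := rho_hi)) => //.
  - by rewrite mulr_ge0 // ltW.
  - by move=> A; have [] := rnd A.
  apply: le_trans (mean_gibbs_risk lam n_gt0 (K2 n) Kn a0 a_le b0 b_le rho_hi_bounds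
    eps0 D0 s0S x0 (le_trans B1le x1) (le_trans B2le N1)) _.
  by apply: lerD B2le; apply: lerD B1le; rewrite lerD2l.
have rhs : expR (xi R M) * (x + x + x + (n%:R * (K n)%:R)^-1 * expR (- u)) <=
    expR (xi R M) * (expR (- 1 * (n%:R * renyi_half n (a n) (b n) / (K n)%:R)) +
      (n%:R * (K n)%:R)^-1 * expR (- (d / (4 * Cdeg)) * eps) +
      (n%:R * (K n)%:R) `^ (- (c0 / 12 * A0))).
  rewrite ler_wpM2l ?expR_ge0 // PE (_ : - (d / (4 * Cdeg)) * eps = - u); last by rewrite /u mulNr.
  have -> : x + x + x = P^-1 by rewrite /x; field; rewrite gt_eqF.
  set J := expR (- 1 * _); have J0 : 0 <= J := expR_ge0 _; lra.
apply: le_trans rhs; set E := [set _ | _ in _].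
(* [ge_sup] asks for a nonempty set; on the empty set [sup] is 0, below a nonnegative bound. *)
have [->|/set0P[v Ev]] := eqVneq E set0; last first.
  by apply: ge_sup => [|_ [s0 s0S <-]]; [exists v|exact: bound].
by rewrite sup0 mulr_ge0 ?expR_ge0 // !addr_ge0 ?(ltW x0) // mulr_ge0 ?expR_ge0.
Qed.
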